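(* $mnl(K_{4,4}) = 2$.
   Context: $K_{n_1,\dots,n_k}$ denotes the complete $k$-partite graph with parts of sizes $n_1,\dots,n_k$. An embedding of a finite graph $G$ means a tame embedding of $G$ in $\mathbb{R}^3$. A link in an embedding is an unordered pair of vertex-disjoint (simple closed) cycles of $G$ whose images form a non-trivial (non-split) two-component link (no three pairwise disjoint cycles exist in the graph considered here); links are counted as pairs of cycles. $mnl(G)$ is the minimal number of links in any embedding of $G$ in $\mathbb{R}^3$. *)

(* Defs.v *)
(* Over an arbitrary model R of the real numbers in MathComp-Analysis. *)
From HB Require Import structures.
From mathcomp Require Import all_boot all_order all_algebra.
From mathcomp Require Import all_classical all_reals all_analysis.
Set Implicit Arguments.
Unset Strict Implicit.
Unset Printing Implicit Defensive.
Import Order.TTheory GRing.Theory Num.Theory.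
Import numFieldNormedType.Exports.

Local Open Scope classical_set_scope.
Local Open Scope ring_scope.

Record sgraph := SGraph {
  vertex :> finType;
  adj : rel vertex;
  adj_sym : symmetric adj;
  adj_irr : irreflexive adj }.

Lemma neq_tag_sym (I : eqType) (T : I -> Type) :
  symmetric (fun u v : {i : I & T i} => tag u != tag v).
Proof. by move=> u v; rewrite eq_sym. Qed.

Lemma neq_tag_irr (I : eqType) (T : I -> Type) :
  irreflexive (fun u v : {i : I & T i} => tag u != tag v).
Proof. by move=> u; rewrite eqxx. Qed.

Definition complete_multipartite (s : seq nat) : sgraph :=
  @SGraph {i : 'I_(size s) & 'I_(nth 0%N s i)} _
    (@neq_tag_sym _ _) (@neq_tag_irr _ _).

Section Graph.
Variable G : sgraph.

Definition edges : {set {set G}} :=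
  [set [set p.1; p.2] | p in [pred p : G * G | adj p.1 p.2]]%SET.

Definition simplices : {set {set G}} :=
  ([set [set x] | x : G] :|: edges)%SET.

(* A cycle of G is represented by its set of edges; the sequence c lists its
   vertices in cyclic order. *)
Definition is_cycle (C : {set {set G}}) : Prop :=
  exists c : seq G, [/\ ucycle (@adj G) c, (2 < size c)%N &
    C = [set [set x; next c x] | x in c]%SET].

End Graph.

Section Embedding.
Variable R : realType.

Local Notation R3 := 'rV[R]_3.

(* Barycentric coordinates; as V is finite, this carries the usual topology of
   a finite-dimensional real vector space. *)
Definition bary (V : finType) := prod_topology (fun _ : V => R).

Definition barycenter (V : finType) (x : V) : bary V := fun v => (v == x)%:R.

(* Geometric realization of the simplicial complex generated by K. *)
Definition realization (V : finType) (K : {set {set V}}) : set (bary V) :=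
  [set w | [/\ forall v, 0 <= w v, \sum_v w v = 1 &
    exists2 s : {set V}, s \in K & forall v, v \notin s -> w v = 0]].

Definition homeomorphism (h : R3 -> R3) : Prop :=
  continuous h /\
  exists g : R3 -> R3, [/\ continuous g, cancel h g & cancel g h].

Definition segment (a b : R3) : set R3 :=
  [set (1 - t) *: a + t *: b | t in [set t : R | 0 <= t <= 1]].

Fixpoint polyline (a : R3) (s : seq R3) : set R3 :=
  if s is b :: s' then segment a b `|` polyline b s' else [set a].

Section SpatialGraph.
Variables (G : sgraph) (f : bary G -> R3).

Definition embedding : Prop :=
  {within realization (simplices G), continuous f} /\
  {in realization (simplices G) &, injective f}.

(* Tame: some homeomorphism of space carries every edge to a polygonal arc. *)
Definition tame : Prop :=
  exists2 h : R3 -> R3, homeomorphism h &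
    forall x y : G, adj x y -> exists s : seq R3,
      (h \o f) @` realization [set [set x; y]%SET]%SET =
      polyline (h (f (barycenter x))) (rcons s (h (f (barycenter y)))).

End SpatialGraph.

(* The norm of 'rV[R]_3 is the sup norm, hence the explicit Euclidean one. *)
Definition sqnorm (x : R3) : R := \sum_i x ord0 i ^+ 2.

(* A and B are separated by the tame sphere that h maps to the unit sphere. *)
Definition split_link (A B : set R3) : Prop :=
  exists2 h : R3 -> R3, homeomorphism h &
    (h @` A `<=` [set x | sqnorm x < 1] /\
     h @` B `<=` [set x | 1 < sqnorm x]) \/
    (h @` B `<=` [set x | sqnorm x < 1] /\
     h @` A `<=` [set x | 1 < sqnorm x]).

Definition is_link (G : sgraph) (f : bary G -> R3)
    (L : {set {set {set G}}}) : Prop :=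
  exists C D : {set {set G}}, [/\ L = [set C; D]%SET,
    is_cycle C, is_cycle D, [disjoint finset.cover C & finset.cover D]%B &
    ~ split_link (f @` realization C) (f @` realization D)].

Definition nlinks (G : sgraph) (f : bary G -> R3) : nat :=
  #|[pred L : {set {set {set G}}} | `[< is_link f L >]]|.

Definition link_numbers (G : sgraph) : set nat :=
  [set n | exists f : bary G -> R3,
    [/\ embedding f, tame f & nlinks f = n]].

(* The least element of link_numbers G (0 if that set were empty). *)
Definition mnl (G : sgraph) : nat :=
  xget 0%N (link_numbers G `&` [set n | forall m, link_numbers G m -> (n <= m)%N]).

End Embedding.

(* Main.v *)
Require Import Defs.
From mathcomp Require Import all_boot all_order all_algebra.
From mathcomp Require Import perm ring lra.
From mathcomp Require Import all_classical all_reals all_analysis.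

Set Implicit Arguments.
Unset Strict Implicit.
Unset Printing Implicit Defensive.
Import Order.TTheory GRing.Theory Num.Theory.
Import numFieldNormedType.Exports.
Local Open Scope classical_set_scope.
Local Open Scope ring_scope.

(** The lower bound and the upper bound are independent.

    Lower bound.  There are 18 pairs of disjoint cycles in $K_{4,4}$, all of
    them pairs of complementary 4-cycles, and an edge is missed by exactly
    nine of them.  The sum modulo 2 of the linking numbers of these nine pairs
    does not depend on the embedding: if one edge is replaced by another arc,
    the sum changes by the linking number of a closed curve with a sum of
    cycles in which every edge occurs an even number of times.  For a
    straight copy with vertices on the moment curve the sum is 1
    (link_parity).  Hence for every edge some nonsplit link misses this edge;
    applied once, and then again to an edge of the link found first, this
    gives two links (nlinks_ge2).

    Linking numbers are only needed for polygons.  The linking number of two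
    polygons counts, modulo 2, the edges of the second one that pierce the
    triangles of a cone over the first one; for points in general position
    piercing is read off from the signs of 4-point orientations, and all that
    is needed about it (cut_tetrahedron, link_swap) follows from the
    Grassmann-Pluecker relations.  Given an arbitrary embedding whose nine
    pairs would all be split, the separating homeomorphisms contract one cycle
    of each pair in the complement of the other.  The edges and these
    contractions are replaced by fine grids of points in general position,
    along which the linking numbers remain constant until they vanish, against
    the parity (contraction_obstruction).

    Upper bound.  The red vertices are put on one of two skew lines and the
    blue ones on the other, two on each side of the common perpendicular, and
    all edges are straight.  Seen along the perpendicular this is a drawing
    with four crossings, and for 16 of the 18 pairs one cycle passes over the
    other at each crossing between them (only_two_entangled).  Such a pair is
    split: a continuous function whose graph lies between the two cycles gives
    a shear of space after which a plane, hence also a large sphere, separates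
    them (above_split). *)

(** * Orientations and piercing *)

Definition both (P : bool -> bool) := P true && P false.
Lemma both_bools P : both P -> forall b, P b.
Proof. by case/andP=> ? ? []. Qed.

(** The arguments are the signs of abcd, abce, abde, bcde and cade: the segment
    de meets the triangle abc iff d and e are on different sides of its plane
    and the line de runs around the three edges in the same direction. *)
Definition pierceb (p q r s t : bool) := [&& p != q, r == s & s == t].

(** The arguments are the signs of abcd, ebcd, aecd, abed and abce: the point e
    is inside the tetrahedron abcd iff putting it in place of any vertex
    preserves the orientation. *)
Definition insideb (p q r s t : bool) := [&& p == q, p == r, p == s & p == t].

(** The signs of the orientations that omit the first, ..., the fifth of five
    points.  Taken with alternating signs, these orientations sum to 0. *)
Definition acyclicb (p q r s t : bool) := ~~ [&& p != q, q != r, r != s & s != t].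

(** The signs of x, y, z, w, u, v when x y - z w + u v = 0: the three terms
    cannot all have the same sign. *)
Definition pluckerb (p q r s t u : bool) :=
  ~~ (((p == q) == (t == u)) && ((p == q) != (r == s))).

(** One constraint for each of the 15 ways to choose the two points shared by
    all the orientations of a three-term relation on six points. *)
Definition plucker_axioms
    (abcd abce abcf abde abdf abef acde acdf acef adef
     bcde bcdf bcef bdef cdef : bool) :=
  [&& pluckerb abcd abef abce abdf abcf abde,
      pluckerb (~~ abcd) acef (~~ abce) acdf (~~ abcf) acde,
      pluckerb abcd adef (~~ abde) (~~ acdf) (~~ abdf) (~~ acde),
      pluckerb abce (~~ adef) abde (~~ acef) (~~ abef) acde,
      pluckerb abcf adef abdf acef abef acdf,
      pluckerb abcd bcef abce bcdf abcf bcde,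
      pluckerb (~~ abcd) bdef abde (~~ bcdf) abdf (~~ bcde),
      pluckerb (~~ abce) (~~ bdef) (~~ abde) (~~ bcef) abef bcde,
      pluckerb (~~ abcf) bdef (~~ abdf) bcef (~~ abef) bcdf,
      pluckerb abcd cdef acde bcdf acdf bcde,
      pluckerb abce (~~ cdef) (~~ acde) bcef acef (~~ bcde),
      pluckerb abcf cdef (~~ acdf) (~~ bcef) (~~ acef) (~~ bcdf),
      pluckerb abde cdef acde bdef adef bcde,
      pluckerb abdf (~~ cdef) acdf (~~ bdef) (~~ adef) bcdf &
      pluckerb abef cdef acef bdef adef bcef].

(** A segment ef crosses the boundary of a tetrahedron an odd number of times
    iff exactly one of its ends is inside.  Over signs this is a finite check,
    in which acyclicity excludes the configurations of vectors that do not
    come from points. *)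
Lemma tetrahedron_signs
    (abcd abce abcf abde abdf abef acde acdf acef adef
     bcde bcdf bcef bdef cdef : bool) :
  plucker_axioms abcd abce abcf abde abdf abef acde acdf acef adef
    bcde bcdf bcef bdef cdef ->
  acyclicb bcde acde abde abce abcd -> acyclicb bcdf acdf abdf abcf abcd ->
  (pierceb bcde bcdf bcef cdef (~~ bdef)) (+)
  (pierceb acde acdf acef cdef (~~ adef)) (+)
  (pierceb abde abdf abef bdef (~~ adef)) (+)
  (pierceb abce abcf abef bcef (~~ acef)) =
  (insideb abcd (~~ bcde) acde (~~ abde) abce) (+)
  (insideb abcd (~~ bcdf) acdf (~~ abdf) abcf).
Proof.
move=> H1 H2 H3; apply/eqP.
move: H3; apply/implyP; move: H2; apply/implyP; move: H1; apply/implyP.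
move: cdef; apply: both_bools. move: bdef; apply: both_bools.
move: bcef; apply: both_bools. move: bcdf; apply: both_bools.
move: bcde; apply: both_bools. move: adef; apply: both_bools.
move: acef; apply: both_bools. move: acdf; apply: both_bools.
move: acde; apply: both_bools. move: abef; apply: both_bools.
move: abdf; apply: both_bools. move: abde; apply: both_bools.
move: abcf; apply: both_bools. move: abce; apply: both_bools.
move: abcd; apply: both_bools.
by vm_compute.
Qed.

(** Two triangles in general position are disjoint or meet in a segment, and
    each end of that segment is a point where an edge of one triangle pierces
    the other one. *)
Lemma triangles_signs
    (abcd abce abcf abde abdf abef acde acdf acef adef
     bcde bcdf bcef bdef cdef : bool) :
  plucker_axioms abcd abce abcf abde abdf abef acde acdf acef adef
    bcde bcdf bcef bdef cdef ->
  (pierceb abcd abce abde bcde (~~ acde)) (+)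
  (pierceb abce abcf abef bcef (~~ acef)) (+)
  (pierceb abcd abcf abdf bcdf (~~ acdf)) =
  (pierceb (~~ adef) (~~ bdef) abde abef (~~ abdf)) (+)
  (pierceb (~~ bdef) (~~ cdef) bcde bcef (~~ bcdf)) (+)
  (pierceb (~~ adef) (~~ cdef) acde acef (~~ acdf)).
Proof.
move=> H1; apply/eqP; move: H1; apply/implyP.
move: cdef; apply: both_bools. move: bdef; apply: both_bools.
move: bcef; apply: both_bools. move: bcdf; apply: both_bools.
move: bcde; apply: both_bools. move: adef; apply: both_bools.
move: acef; apply: both_bools. move: acdf; apply: both_bools.
move: acde; apply: both_bools. move: abef; apply: both_bools.
move: abdf; apply: both_bools. move: abde; apply: both_bools.
move: abcf; apply: both_bools. move: abce; apply: both_bools.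
move: abcd; apply: both_bools.
by vm_compute.
Qed.

Section Orientation.
Variable R : realFieldType.
Implicit Types a b c d e f : 'rV[R]_3.

Definition cx (p : 'rV[R]_3) : R := p ord0 (inord 0).
Definition cy (p : 'rV[R]_3) : R := p ord0 (inord 1).
Definition cz (p : 'rV[R]_3) : R := p ord0 (inord 2).

Definition orient a b c d : R :=
  (cx b - cx a) * ((cy c - cy a) * (cz d - cz a) - (cz c - cz a) * (cy d - cy a))
  - (cy b - cy a) * ((cx c - cx a) * (cz d - cz a) - (cz c - cz a) * (cx d - cx a))
  + (cz b - cz a) * ((cx c - cx a) * (cy d - cy a) - (cy c - cy a) * (cx d - cx a)).

Lemma orient_swap12 a b c d : orient a b c d = - orient b a c d.
Proof. by rewrite /orient; ring. Qed.
Lemma orient_swap23 b c a d : orient a b c d = - orient a c b d.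
Proof. by rewrite /orient; ring. Qed.
Lemma orient_swap34 c d a b : orient a b c d = - orient a b d c.
Proof. by rewrite /orient; ring. Qed.

Lemma grassmann_plucker a b c d e f :
  orient a b c d * orient a b e f - orient a b c e * orient a b d f
  + orient a b c f * orient a b d e = 0.
Proof. by rewrite /orient; ring. Qed.

Definition pos a b c d := 0 < orient a b c d.

Definition pierce a b c d e :=
  pierceb (pos a b c d) (pos a b c e) (pos a b d e) (pos b c d e) (pos c a d e).

Definition inside a b c d e :=
  insideb (pos a b c d) (pos e b c d) (pos a e c d) (pos a b e d) (pos a b c e).

Lemma gt0_mul_sign (a b : R) : a != 0 -> b != 0 ->
  (0 < a * b) = ((0 < a) == (0 < b)).
Proof.
move=> a0 b0; case: (ltgtP 0 a) a0 => // a0 _; case: (ltgtP 0 b) b0 => // b0 _.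
- by rewrite pmulr_rgt0.
- by rewrite pmulr_rgt0 //; apply/negbTE; rewrite -leNgt ltW.
- by rewrite nmulr_rgt0 //; apply/negbTE; rewrite -leNgt ltW.
- by rewrite nmulr_rgt0.
Qed.

Lemma plucker_sign (x y z w u v : R) : x != 0 -> y != 0 -> z != 0 -> w != 0 ->
  u != 0 -> v != 0 -> x * y - z * w + u * v = 0 ->
  pluckerb (0 < x) (0 < y) (0 < z) (0 < w) (0 < u) (0 < v).
Proof.
rewrite /pluckerb => x0 y0 z0 w0 u0 v0 E.
rewrite -(@gt0_mul_sign x) // -(@gt0_mul_sign z) // -(@gt0_mul_sign u) //.
have: x * y != 0 by rewrite mulf_neq0.
have: z * w != 0 by rewrite mulf_neq0.
have: u * v != 0 by rewrite mulf_neq0.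
move: (x * y) (z * w) (u * v) E  => p q r E.
by case: (ltgtP 0 p) => // ?; case: (ltgtP 0 q) => // ?; case: (ltgtP 0 r) => // ? _ _ _; lra.
Qed.

End Orientation.

Section GenericPosition.
Variables (R : realFieldType) (T : eqType) (x : T -> 'rV[R]_3).

Definition generic :=
  forall a b c d, uniq [:: a; b; c; d] -> orient (x a) (x b) (x c) (x d) != 0.

Hypothesis x_gen : generic.

(** False as soon as two vertices coincide, so that chains may contain
    degenerate edges and triangles. *)
Definition hit a b c d e :=
  uniq [:: a; b; c; d; e] && pierce (x a) (x b) (x c) (x d) (x e).

Definition within a b c d e :=
  uniq [:: a; b; c; d; e] && inside (x a) (x b) (x c) (x d) (x e).

Lemma orient_alternating_sum (y0 y1 y2 y3 y4 : 'rV[R]_3) :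
  orient y1 y2 y3 y4 - orient y0 y2 y3 y4 + orient y0 y1 y3 y4
  - orient y0 y1 y2 y4 + orient y0 y1 y2 y3 = 0.
Proof. by rewrite /orient; ring. Qed.

Lemma acyclic_sign (p q r s t : R) :
  p != 0 -> q != 0 -> r != 0 -> s != 0 -> t != 0 ->
  p - q + r - s + t = 0 -> acyclicb (0 < p) (0 < q) (0 < r) (0 < s) (0 < t).
Proof.
rewrite /acyclicb.
case: (ltgtP 0 p) => //; case: (ltgtP 0 q) => //; case: (ltgtP 0 r) => //;
case: (ltgtP 0 s) => //; case: (ltgtP 0 t) => //= *; lra.
Qed.

Section Six.
Variables a b c d e f : T.
Hypothesis abcdef_uniq : uniq [:: a; b; c; d; e; f].

Let o p q r s := orient (x p) (x q) (x r) (x s).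
Let sw12 p q r s : o p q r s = - o q p r s.
Proof. exact: orient_swap12. Qed.
Let sw23 p q r s : o r p q s = - o r q p s.
Proof. exact: orient_swap23. Qed.
Let sw34 p q r s : o r s p q = - o r s q p.
Proof. exact: orient_swap34. Qed.

Let s12 := (sw12 b a, sw12 c a, sw12 d a, sw12 e a, sw12 f a, sw12 c b,
  sw12 d b, sw12 e b, sw12 f b, sw12 d c, sw12 e c, sw12 f c, sw12 e d,
  sw12 f d, sw12 f e).
Let s23 := (sw23 b a, sw23 c a, sw23 d a, sw23 e a, sw23 f a, sw23 c b,
  sw23 d b, sw23 e b, sw23 f b, sw23 d c, sw23 e c, sw23 f c, sw23 e d,
  sw23 f d, sw23 f e).
Let s34 := (sw34 b a, sw34 c a, sw34 d a, sw34 e a, sw34 f a, sw34 c b,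
  sw34 d b, sw34 e b, sw34 f b, sw34 d c, sw34 e c, sw34 f c, sw34 e d,
  sw34 f d, sw34 f e).

Let or_nz m p q r s : mask m [:: a; b; c; d; e; f] = [:: p; q; r; s] ->
  (o p q r s == 0) = false.
Proof. by move=> E; apply/negbTE/x_gen; rewrite -E mask_uniq. Qed.

Let pos_neg m p q r s : mask m [:: a; b; c; d; e; f] = [:: p; q; r; s] ->
  (0 < - o p q r s) = ~~ (0 < o p q r s).
Proof. by move=> /or_nz nz; rewrite oppr_gt0 ltNge le_eqVlt eq_sym nz. Qed.

Let nz := (@or_nz [:: true; true; true; true; false; false] _ _ _ _ erefl,
  @or_nz [:: true; true; true; false; true; false] _ _ _ _ erefl,
  @or_nz [:: true; true; true; false; false; true] _ _ _ _ erefl,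
  @or_nz [:: true; true; false; true; true; false] _ _ _ _ erefl,
  @or_nz [:: true; true; false; true; false; true] _ _ _ _ erefl,
  @or_nz [:: true; true; false; false; true; true] _ _ _ _ erefl,
  @or_nz [:: true; false; true; true; true; false] _ _ _ _ erefl,
  @or_nz [:: true; false; true; true; false; true] _ _ _ _ erefl,
  @or_nz [:: true; false; true; false; true; true] _ _ _ _ erefl,
  @or_nz [:: true; false; false; true; true; true] _ _ _ _ erefl,
  @or_nz [:: false; true; true; true; true; false] _ _ _ _ erefl,
  @or_nz [:: false; true; true; true; false; true] _ _ _ _ erefl,
  @or_nz [:: false; true; true; false; true; true] _ _ _ _ erefl,
  @or_nz [:: false; true; false; true; true; true] _ _ _ _ erefl,
  @or_nz [:: false; false; true; true; true; true] _ _ _ _ erefl).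
Let pn := (@pos_neg [:: true; true; true; true; false; false] _ _ _ _ erefl,
  @pos_neg [:: true; true; true; false; true; false] _ _ _ _ erefl,
  @pos_neg [:: true; true; true; false; false; true] _ _ _ _ erefl,
  @pos_neg [:: true; true; false; true; true; false] _ _ _ _ erefl,
  @pos_neg [:: true; true; false; true; false; true] _ _ _ _ erefl,
  @pos_neg [:: true; true; false; false; true; true] _ _ _ _ erefl,
  @pos_neg [:: true; false; true; true; true; false] _ _ _ _ erefl,
  @pos_neg [:: true; false; true; true; false; true] _ _ _ _ erefl,
  @pos_neg [:: true; false; true; false; true; true] _ _ _ _ erefl,
  @pos_neg [:: true; false; false; true; true; true] _ _ _ _ erefl,
  @pos_neg [:: false; true; true; true; true; false] _ _ _ _ erefl,
  @pos_neg [:: false; true; true; true; false; true] _ _ _ _ erefl,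
  @pos_neg [:: false; true; true; false; true; true] _ _ _ _ erefl,
  @pos_neg [:: false; true; false; true; true; true] _ _ _ _ erefl,
  @pos_neg [:: false; false; true; true; true; true] _ _ _ _ erefl).

Let gp p q r s t u :
  o p q r s != 0 -> o p q t u != 0 -> o p q r t != 0 -> o p q s u != 0 ->
  o p q r u != 0 -> o p q s t != 0 ->
  pluckerb (0 < o p q r s) (0 < o p q t u) (0 < o p q r t) (0 < o p q s u)
      (0 < o p q r u) (0 < o p q s t).
Proof. by move=> *; apply: plucker_sign => //; apply: grassmann_plucker. Qed.

Local Ltac sort_points :=
  rewrite ?(s12, s23, s34) ?opprK ?oppr_eq0 !nz ?pn;
  move/(_ isT isT isT isT isT isT).

Let axioms : plucker_axioms (0 < o a b c d) (0 < o a b c e) (0 < o a b c f)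
  (0 < o a b d e) (0 < o a b d f) (0 < o a b e f) (0 < o a c d e)
  (0 < o a c d f) (0 < o a c e f) (0 < o a d e f) (0 < o b c d e)
  (0 < o b c d f) (0 < o b c e f) (0 < o b d e f) (0 < o c d e f).
Proof.
(* One three-term relation for each pair of points shared by its six factors. *)
have := @gp a b c d e f; sort_points => Hab.
have := @gp a c b d e f; sort_points => Hac.
have := @gp a d b c e f; sort_points => Had.
have := @gp a e b c d f; sort_points => Hae.
have := @gp a f b c d e; sort_points => Haf.
have := @gp b c a d e f; sort_points => Hbc.
have := @gp b d a c e f; sort_points => Hbd.
have := @gp b e a c d f; sort_points => Hbe.
have := @gp b f a c d e; sort_points => Hbf.
have := @gp c d a b e f; sort_points => Hcd.
have := @gp c e a b d f; sort_points => Hce.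
have := @gp c f a b d e; sort_points => Hcf.
have := @gp d e a b c f; sort_points => Hde.
have := @gp d f a b c e; sort_points => Hdf.
have := @gp e f a b c d; sort_points => Hef.
by rewrite /plucker_axioms; do 14![apply/andP; split => //].
Qed.

Let acyc p q r s t :
  o q r s t != 0 -> o p r s t != 0 -> o p q s t != 0 -> o p q r t != 0 ->
  o p q r s != 0 -> acyclicb (0 < o q r s t) (0 < o p r s t) (0 < o p q s t)
    (0 < o p q r t) (0 < o p q r s).
Proof. by move=> *; apply: acyclic_sign => //; apply: orient_alternating_sum. Qed.

Let acyc_e : acyclicb (0 < o b c d e) (0 < o a c d e) (0 < o a b d e)
    (0 < o a b c e) (0 < o a b c d).
Proof. by apply: acyc; rewrite nz. Qed.

Let acyc_f : acyclicb (0 < o b c d f) (0 < o a c d f) (0 < o a b d f)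
    (0 < o a b c f) (0 < o a b c d).
Proof. by apply: acyc; rewrite nz. Qed.

Let distinct m s : mask m [:: a; b; c; d; e; f] = s -> uniq s.
Proof. by move=> <-; rewrite mask_uniq. Qed.

Let hitE p q r s t : uniq [:: p; q; r; s; t] -> hit p q r s t =
  pierceb (0 < o p q r s) (0 < o p q r t) (0 < o p q s t) (0 < o q r s t)
    (0 < o r p s t).
Proof. by rewrite /hit => ->. Qed.

Let withinE p q r s t : uniq [:: p; q; r; s; t] -> within p q r s t =
  insideb (0 < o p q r s) (0 < o t q r s) (0 < o p t r s) (0 < o p q t s)
    (0 < o p q r t).
Proof. by rewrite /within => ->. Qed.

Let uniqs := (@distinct [:: false; true; true; true; true; true] _ erefl,
  @distinct [:: true; false; true; true; true; true] _ erefl,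
  @distinct [:: true; true; false; true; true; true] _ erefl,
  @distinct [:: true; true; true; false; true; true] _ erefl,
  @distinct [:: true; true; true; true; false; true] _ erefl,
  @distinct [:: true; true; true; true; true; false] _ erefl).

Lemma hit_tetrahedron_uniq :
  hit b c d e f (+) hit a c d e f (+) hit a b d e f (+) hit a b c e f =
  within a b c d e (+) within a b c d f.
Proof.
rewrite !(hitE, withinE) ?uniqs //.
rewrite ?(s12, s23, s34) ?opprK ?pn.
exact: tetrahedron_signs axioms acyc_e acyc_f.
Qed.

Lemma hit_triangles_uniq :
  hit a b c d e (+) hit a b c e f (+) hit a b c d f =
  hit d e f a b (+) hit d e f b c (+) hit d e f a c.
Proof.
rewrite !hitE ?uniqs //; try by rewrite -(rot_uniq 3) uniqs.
rewrite ?(s12, s23, s34) ?opprK ?pn.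
exact: triangles_signs axioms.
Qed.

End Six.

Lemma pos_swap12 a b c d : uniq [:: a; b; c; d] ->
  pos (x b) (x a) (x c) (x d) = ~~ pos (x a) (x b) (x c) (x d).
Proof.
move=> /x_gen nz; rewrite /pos orient_swap12 oppr_gt0 ltNge le_eqVlt eq_sym.
by rewrite (negPf nz).
Qed.

Lemma pos_swap23 a b c d : uniq [:: a; b; c; d] ->
  pos (x a) (x c) (x b) (x d) = ~~ pos (x a) (x b) (x c) (x d).
Proof.
move=> /x_gen nz; rewrite /pos orient_swap23 oppr_gt0 ltNge le_eqVlt eq_sym.
by rewrite (negPf nz).
Qed.

Lemma pos_swap34 a b c d : uniq [:: a; b; c; d] ->
  pos (x a) (x b) (x d) (x c) = ~~ pos (x a) (x b) (x c) (x d).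
Proof.
move=> /x_gen nz; rewrite /pos orient_swap34 oppr_gt0 ltNge le_eqVlt eq_sym.
by rewrite (negPf nz).
Qed.

Lemma uniq_quadruples (a b c d e : T) : uniq [:: a; b; c; d; e] ->
  [/\ uniq [:: a; b; c; d], uniq [:: a; b; c; e], uniq [:: a; b; d; e],
      uniq [:: b; c; d; e] & uniq [:: c; a; d; e]].
Proof.
move=> U; have S (m : bitseq) (s : seq T) : mask m [:: a; b; c; d; e] = s -> uniq s.
  by move=> <-; rewrite mask_uniq.
split; [exact: (S [:: true; true; true; true])
  | exact: (S [:: true; true; true; false; true])
  | exact: (S [:: true; true; false; true; true])
  | exact: (S [:: false; true; true; true; true])
  | rewrite (perm_uniq (permEl (perm_catCA [:: c] [:: a] [:: d; e])));
    exact: (S [:: true; false; true; true; true])].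
Qed.

Lemma hit_swap45 a b c d e : hit a b c e d = hit a b c d e.
Proof.
have E : uniq [:: a; b; c; e; d] = uniq [:: a; b; c; d; e].
  by apply: perm_uniq; rewrite !perm_cons (perm_catC [:: e] [:: d]).
rewrite /hit E {E}; apply: andb_id2l => /uniq_quadruples[abcd abce abde bcde cade].
rewrite /pierce (pos_swap34 abde) (pos_swap34 bcde) (pos_swap34 cade) /pierceb.
by do ![case: (pos _ _ _ _)].
Qed.

Lemma hit_swap12 a b c d e : hit b a c d e = hit a b c d e.
Proof.
have E : uniq [:: b; a; c; d; e] = uniq [:: a; b; c; d; e].
  by apply: perm_uniq; rewrite (perm_catCA [:: b] [:: a]).
rewrite /hit E {E}; apply: andb_id2l => /uniq_quadruples[abcd abce abde bcde cade].
rewrite /pierce (pos_swap12 abcd) (pos_swap12 abce) (pos_swap12 abde) (pos_swap12 bcde)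
  (pos_swap12 cade) /pierceb.
by do ![case: (pos _ _ _ _)].
Qed.

Lemma hit_swap23 a b c d e : hit a c b d e = hit a b c d e.
Proof.
have E : uniq [:: a; c; b; d; e] = uniq [:: a; b; c; d; e].
  by apply: perm_uniq; rewrite perm_cons (perm_catCA [:: c] [:: b]).
rewrite /hit E {E}; apply: andb_id2l => /uniq_quadruples[abcd abce abde bcde cade].
rewrite /pierce (pos_swap23 abcd) (pos_swap23 abce) (pos_swap12 abde) (pos_swap12 bcde)
  (pos_swap12 cade) /pierceb.
by do ![case: (pos _ _ _ _)].
Qed.

Lemma hit_dup a b c d e : [|| a == b, a == c, b == c | d == e] ->
  hit a b c d e = false.
Proof.
by case/or4P=> /eqP->; rewrite /hit /= !inE eqxx ?orbT ?andbF //= ?orbT ?andbF.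
Qed.

Lemma within_dup a b c d e :
  [|| a == b, a == c, a == d, b == c, b == d | c == d] ->
  within a b c d e = false.
Proof.
do 5?[case/orP]; move=> /eqP->;
by rewrite /within /= !inE eqxx ?orbT ?andbF //= ?orbT ?andbF.
Qed.

Lemma hit_tetrahedron a b c d e f :
  all (fun v => v \notin [:: e; f]) [:: a; b; c; d] ->
  hit b c d e f (+) hit a c d e f (+) hit a b d e f (+) hit a b c e f =
  within a b c d e (+) within a b c d f.
Proof.
move=> H; have [<-|ef] := eqVneq e f.
  by rewrite !hit_dup ?eqxx ?orbT // !addbb.
have [dup|] := boolP [|| a == b, a == c, a == d, b == c, b == d | c == d].
  have D1 p q v w : hit p p q v w = false by rewrite hit_dup ?eqxx.
  have D2 p q v w : hit p q p v w = false by rewrite hit_dup ?eqxx ?orbT.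
  have D3 p q v w : hit p q q v w = false by rewrite hit_dup ?eqxx ?orbT.
  rewrite !(within_dup _ dup); do 5?[case/orP: dup => dup]; move: dup => /eqP->;
    rewrite ?(D1, D2, D3).
  - by rewrite addbb.
  - by rewrite hit_swap12 addbF addbF addbb.
  - by rewrite addbF hit_swap23 hit_swap12 addbF addbb.
  - by rewrite addFb addbF addbb.
  - by rewrite addFb hit_swap23 addbF addbb.
  - by rewrite !addFb addbb.
rewrite !negb_or => /and5P[ab ac ad bc /andP[bd cd]].
apply: hit_tetrahedron_uniq; move: H; rewrite /= !inE !negb_or.
case/and5P=> /andP[ae af] /andP[be bf] /andP[ce cf] /andP[de df] _.
by rewrite ab ac ad bc bd cd ae af be bf ce cf de df ef.
Qed.

Lemma hit_triangles a b c d e f :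
  all (fun v => v \notin [:: d; e; f]) [:: a; b; c] ->
  hit a b c d e (+) hit a b c e f (+) hit a b c d f =
  hit d e f a b (+) hit d e f b c (+) hit d e f a c.
Proof.
have D p q r s t u : [|| p == q, p == r | q == r] ->
  hit p q r s t (+) hit p q r t u (+) hit p q r s u =
  hit s t u p q (+) hit s t u q r (+) hit s t u p r.
  move=> dup; have Z v w : hit p q r v w = false.
    by apply: hit_dup; case/or3P: dup => ->; rewrite ?orbT.
  rewrite !{}Z.
  case/or3P: dup => /eqP->.
  - by rewrite (hit_dup (d := q) (e := q)) ?eqxx ?orbT // !addFb addbb.
  - by rewrite (hit_dup (d := r) (e := r)) ?eqxx ?orbT // !addbF hit_swap45 addbb.
  - by rewrite (hit_dup (d := r) (e := r)) ?eqxx ?orbT // !addbF addbb.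
move=> H; have [/D //|] := boolP [|| a == b, a == c | b == c].
rewrite !negb_or => /and3P[ab ac bc].
have [/D <- //|] := boolP [|| d == e, d == f | e == f].
rewrite !negb_or => /and3P[de df ef].
apply: hit_triangles_uniq; move: H; rewrite /= !inE !negb_or.
case/and4P=> /and3P[ad ae af] /and3P[bd be bf] /and3P[cd ce cf] _.
by rewrite ab ac ad bc bd cd ae af be bf ce cf de df ef.
Qed.

Lemma vector3P (y z : 'rV[R]_3) : cx y = cx z -> cy y = cy z -> cz y = cz z -> y = z.
Proof.
move=> ex ey ez; apply/rowP => -[[|[|[|//]]] lt_i].
- by move: ex; rewrite /cx (_ : inord 0 = Ordinal lt_i) //; apply/val_inj; rewrite /= inordK.
- by move: ey; rewrite /cy (_ : inord 1 = Ordinal lt_i) //; apply/val_inj; rewrite /= inordK.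
- by move: ez; rewrite /cz (_ : inord 2 = Ordinal lt_i) //; apply/val_inj; rewrite /= inordK.
Qed.

(** By Cramer's rule the five orientations are, up to a common factor, the
    coefficients of an affine dependency between the five points; its signs
    give the common point. *)
Lemma hit_meet a b c d e : hit a b c d e ->
  exists u v w s t, [/\ 0 <= u, 0 <= v, 0 <= w, u + v + w = 1 &
  [/\ 0 <= s, 0 <= t, s + t = 1 &
    u *: x a + v *: x b + w *: x c = s *: x d + t *: x e]].
Proof.
case/andP=> /uniq_quadruples[/x_gen abcd /x_gen abce /x_gen abde /x_gen bcde /x_gen cade].
rewrite /pierce /pierceb /pos => /and3P[opp /eqP E1 /eqP E2].
(* The equations of the dependency: its total weight here, its coordinates below. *)
have sum1 : orient (x b) (x c) (x d) (x e) + orient (x c) (x a) (x d) (x e) +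
   orient (x a) (x b) (x d) (x e) =
   orient (x a) (x b) (x c) (x e) - orient (x a) (x b) (x c) (x d).
  by rewrite /orient; ring.
have comb (k : 'I_3) : orient (x b) (x c) (x d) (x e) * x a ord0 k +
   orient (x c) (x a) (x d) (x e) * x b ord0 k +
   orient (x a) (x b) (x d) (x e) * x c ord0 k =
   orient (x a) (x b) (x c) (x e) * x d ord0 k -
   orient (x a) (x b) (x c) (x d) * x e ord0 k.
  have [->|->|->] : [\/ k = inord 0, k = inord 1 | k = inord 2].
    case: k => [[|[|[|//]]] lt_k]; [apply: Or31 | apply: Or32 | apply: Or33];
    by apply/val_inj; rewrite /= inordK.
  - by rewrite -!/(cx _) /orient; ring.
  - by rewrite -!/(cy _) /orient; ring.
  - by rewrite -!/(cz _) /orient; ring.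
move: abcd abce abde bcde cade opp E1 E2 sum1 comb.
move: (orient (x a) (x b) (x c) (x d)) (orient (x a) (x b) (x c) (x e))
  (orient (x a) (x b) (x d) (x e)) (orient (x b) (x c) (x d) (x e))
  (orient (x c) (x a) (x d) (x e)) => p q r s t p0 q0 r0 s0 t0 opp E1 E2 sum1 comb.
pose m := q - p.
have [sg m0] : {in [:: s; t; r; q; - p], forall y, 0 <= y / m} /\ m != 0.
  have [s_gt0|s_le0] := ltrP 0 s.
    have [t_gt0 r_gt0] : 0 < t /\ 0 < r by rewrite -E2 E1.
    have m_gt0 : 0 < m by rewrite /m -sum1 !addr_gt0.
    have [q_gt0 p_lt0] : 0 < q /\ p < 0.
      by move: p0 q0 opp; rewrite /m in m_gt0; case: (ltrgt0P p); case: (ltrgt0P q) => //; lra.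
    split; last exact: lt0r_neq0.
    by move=> y; rewrite !inE => /or4P[|||/orP[]] /eqP->; apply: divr_ge0;
       rewrite ?oppr_ge0 ltW.
  have s_lt0 : s < 0 by rewrite lt_neqAle s0.
  have t_lt0 : t < 0 by rewrite lt_neqAle t0 /= leNgt -E2 -leNgt.
  have r_lt0 : r < 0 by rewrite lt_neqAle r0 /= leNgt E1 -leNgt.
  have m_lt0 : m < 0 by rewrite /m -sum1; lra.
  have [q_lt0 p_gt0] : q < 0 /\ 0 < p.
    by move: p0 q0 opp; rewrite /m in m_lt0; case: (ltrgt0P p); case: (ltrgt0P q) => //; lra.
  split; last exact: ltr0_neq0.
  by move=> y; rewrite !inE => /or4P[|||/orP[]] /eqP->;
    rewrite mulr_le0 ?invr_le0 ?oppr_le0 // ltW.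
exists (s / m), (t / m), (r / m), (q / m), (- p / m).
have ? y : y \in [:: s; t; r; q; - p] -> 0 <= y / m by apply: sg.
split; rewrite ?sg ?inE ?eqxx ?orbT //; first by rewrite -!mulrDl sum1 divff.
split; rewrite ?sg ?inE ?eqxx ?orbT //; first by rewrite -!mulrDl divff.
apply/rowP => k; rewrite !mxE !(mulrAC _ m^-1) -!mulrDl comb !mulNr.
by rewrite mulrBl.
Qed.

End GenericPosition.

(** * Linking numbers modulo 2 *)

Notation "\xor_ ( i <- r ) F" := (\big[addb/false]_(i <- r) F)
  (at level 36, F at level 36, i, r at level 50, format "\xor_ ( i  <-  r )  F").

(** Every vertex is an end of an even number of edges, in the form in which
    this is used: a sum over the edges of contributions of their two ends
    vanishes. *)
Definition closed_chain (U : Type) (C : seq (U * U)) :=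
  forall F : U -> bool, \xor_(s <- C) (F s.1 (+) F s.2) = false.

Definition supported (U : Type) (A : pred U) (C : seq (U * U)) :=
  all (fun s => A s.1 && A s.2) C.

Definition map_chain (U V : Type) (f : U -> V) (C : seq (U * U)) :=
  [seq (f s.1, f s.2) | s <- C].

Lemma closed_map_chain (U V : Type) (f : U -> V) C :
  closed_chain C -> closed_chain (map_chain f C).
Proof. by move=> cC F; rewrite big_map (cC (F \o f)). Qed.

Lemma xor_eqP (a b : bool) : a (+) b = false -> a = b.
Proof. by case: a; case: b. Qed.

Lemma xor_even (I : eqType) (r : seq I) (F : I -> bool) :
  all (fun i => ~~ odd (count_mem i r)) r -> \xor_(i <- r) F i = false.
Proof.
move: {2}(size r) (leqnn (size r)) => n; elim: n r => [|n IH] [|i r] //=.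
- by rewrite big_nil.
- by rewrite big_nil.
rewrite ltnS => sz; rewrite eqxx /= negbK => /andP[odd_i ev].
have ri : i \in r by rewrite -has_pred1 has_count; case: (count _ r) odd_i.
rewrite big_cons (perm_big _ (perm_to_rem ri)) /= big_cons addbA addbb addFb.
apply: IH; first by rewrite size_rem // (leq_trans (leq_pred _) sz).
apply/allP => j jr; have := allP ev j (mem_rem jr).
have /seq.permP/(_ (pred1 j)) := perm_to_rem ri; rewrite /= => ->.
by case: (i == j) => //=; rewrite !negbK.
Qed.

Lemma xor_middle (a b c : bool) : b (+) (a (+) b (+) c) = a (+) c.
Proof. by case: a; case: b; case: c. Qed.

Section Linking.
Variables (R : realFieldType) (T : eqType) (x : T -> 'rV[R]_3).
Hypothesis x_gen : generic x.
Implicit Types (C D : seq (T * T)) (A : pred T).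

Definition cut a b c D := \xor_(s <- D) hit x a b c s.1 s.2.

(** For closed C and D this is their linking number modulo 2, computed from
    the cone with apex p over C. *)
Definition link p C D := \xor_(s <- C) cut p s.1 s.2 D.

Lemma link_cat p C1 C2 D : link p (C1 ++ C2) D = link p C1 D (+) link p C2 D.
Proof. by rewrite /link big_cat. Qed.

Lemma link_catr p C D1 D2 : link p C (D1 ++ D2) = link p C D1 (+) link p C D2.
Proof. by rewrite /link -big_split; apply: eq_bigr => s _; rewrite /cut big_cat. Qed.

Lemma link_flatten (I : Type) (r : seq I) (F : I -> seq (T * T)) p D :
  link p (flatten [seq F i | i <- r]) D = \xor_(i <- r) link p (F i) D.
Proof.
elim: r => [|i r IH]; first by rewrite big_nil /link big_nil.
by rewrite big_cons /= link_cat IH.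
Qed.

Lemma link_flattenr (I : Type) (r : seq I) (F : I -> seq (T * T)) p C :
  link p C (flatten [seq F i | i <- r]) = \xor_(i <- r) link p C (F i).
Proof.
elim: r => [|i r IH].
  by rewrite big_nil /link big1 // => s _; rewrite /cut big_nil.
by rewrite big_cons /= link_catr IH.
Qed.

(** A closed chain crosses the boundary of a tetrahedron an even number of
    times, because every vertex of the chain counts twice. *)
Lemma cut_tetrahedron A D a b c d : closed_chain D -> supported (predC A) D ->
  A a -> A b -> A c -> A d ->
  cut b c d D (+) cut a c d D (+) cut a b d D (+) cut a b c D = false.
Proof.
move=> cD sD Aa Ab Ac Ad; rewrite -(cD (within x a b c d)) /cut -!big_split /=.
rewrite big_seq [RHS]big_seq; apply: eq_bigr => s sD'.
apply: hit_tetrahedron => //=; case/andP: (allP sD s sD') => /= s1 s2.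
have N t : A t -> t \notin [:: s.1; s.2].
  by move=> At; rewrite !inE; apply/norP; split; apply: contraTneq At => ->.
by rewrite !N.
Qed.

(** For each edge of C compare the two triangles over it by means of the
    tetrahedron that it spans with p and q; the other faces of these
    tetrahedra cancel around C. *)
Lemma link_apex A C D p q : closed_chain C -> supported A C ->
  closed_chain D -> supported (predC A) D -> A p -> A q ->
  link p C D = link q C D.
Proof.
move=> cC sC cD sD Ap Aq; apply: xor_eqP.
rewrite -(cC (fun t => cut p q t D)) /link -big_split /=.
rewrite big_seq [RHS]big_seq; apply: eq_bigr => s sC'; apply: xor_eqP.
case/andP: (allP sC s sC') => s1 s2.
rewrite -[RHS](cut_tetrahedron cD sD Ap Aq s1 s2).
by case: (cut q _ _ D); case: (cut p s.1 _ D); case: (cut p q s.1 D); case: (cut p q s.2 D).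
Qed.

(** Intersect each triangle of the cone over C with each triangle of the cone
    over D.  In the sum of the relations hit_triangles, the contributions of
    the edges that join an apex to a base cancel. *)
Lemma link_swap A C D p q : closed_chain C -> supported A C ->
  closed_chain D -> supported (predC A) D -> A p -> ~~ A q ->
  link p C D = link q D C.
Proof.
move=> cC sC cD sD Ap Aq.
have -> : link p C D = \xor_(s <- C) \xor_(t <- D) (hit x p s.1 s.2 q t.1 (+)
    hit x p s.1 s.2 t.1 t.2 (+) hit x p s.1 s.2 q t.2).
  apply: eq_bigr => s _; apply: xor_eqP; rewrite /cut -big_split /=.
  rewrite -[RHS](cD (hit x p s.1 s.2 q)); apply: eq_bigr => t _.
  exact: xor_middle.
have -> : link q D C = \xor_(t <- D) \xor_(s <- C) (hit x q t.1 t.2 p s.1 (+)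
    hit x q t.1 t.2 s.1 s.2 (+) hit x q t.1 t.2 p s.2).
  apply: eq_bigr => t _; apply: xor_eqP; rewrite /cut -big_split /=.
  rewrite -[RHS](cC (hit x q t.1 t.2 p)); apply: eq_bigr => s _.
  exact: xor_middle.
rewrite [RHS]exchange_big /= big_seq [RHS]big_seq; apply: eq_bigr => s sC'.
rewrite big_seq [RHS]big_seq; apply: eq_bigr => t tD'.
apply: hit_triangles => //=.
case/andP: (allP sC s sC') (allP sD t tD') => s1 s2 /andP[/= t1 t2].
have N u : A u -> u \notin [:: q; t.1; t.2].
  by move=> Au; rewrite !inE !negb_or; apply/and3P; split; apply: contraTneq Au => ->.
by rewrite !N.
Qed.

Lemma link_comm A C D p q : closed_chain C -> supported A C ->
  closed_chain D -> supported (predC A) D -> p != q ->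
  supported (predC (pred2 p q)) C -> supported (predC (pred2 p q)) D ->
  link p C D = link p D C.
Proof.
move=> cC sC cD sD pq nC nD.
transitivity (link q D C).
  apply: (@link_swap (fun t => (t == p) || (A t && (t != q)))) => //.
  - apply/allP => s sC'; have /andP[/= s1 s2] := allP sC s sC'.
    have /andP[/= /norP[p1 q1] /norP[p2 q2]] := allP nC s sC'.
    by rewrite q1 q2 s1 s2 !orbT.
  - apply/allP => s sD'; have /andP[/= s1 s2] := allP sD s sD'.
    have /andP[/= /norP[p1 q1] /norP[p2 q2]] := allP nD s sD'.
    by rewrite /= !negb_or !negb_and p1 p2 s1 s2.
  - by rewrite eqxx.
  - by rewrite eqxx andbF orbF eq_sym.
apply: (@link_apex (fun t => (t == p) || (t == q) || ~~ A t)) => //.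
- apply/allP => s sD'; have /andP[/= s1 s2] := allP sD s sD'.
  by rewrite s1 s2 !orbT.
- apply/allP => s sC'; have /andP[/= s1 s2] := allP sC s sC'.
  have /andP[/= p1 p2] := allP nC s sC'.
  by rewrite /= !negb_or !negbK -!negb_or p1 p2 s1 s2.
- by rewrite eqxx orbT.
- by rewrite eqxx.
Qed.

(** The edge from f u to f v is moved to the one from g u to g v across a
    quadrilateral, cut into two triangles that D misses. *)
Lemma link_homotopic (U : Type) (f g : U -> T) (C : seq (U * U)) A D p :
  closed_chain C -> closed_chain D -> supported (predC A) D -> A p ->
  supported (fun u => A (f u) && A (g u)) C ->
  all (fun s => ~~ cut (f s.1) (f s.2) (g s.2) D &&
                ~~ cut (f s.1) (g s.1) (g s.2) D) C ->
  link p (map_chain f C) D = link p (map_chain g C) D.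
Proof.
move=> cC cD sD Ap Afg nc; apply: xor_eqP.
rewrite -(cC (fun u => cut p (f u) (g u) D)) /link !big_map -big_split /=.
elim: C Afg nc {cC} => [|s C IH] /=; first by rewrite !big_nil.
case/andP=> /andP[/andP[f1 g1] /andP[f2 g2]] /IH{}IH.
case/andP=> /andP[/negPf n1 /negPf n2] /IH; rewrite !big_cons => ->; congr (_ (+) _).
have := cut_tetrahedron cD sD Ap f1 f2 g2.
have := cut_tetrahedron cD sD Ap f1 g1 g2.
rewrite n1 n2 => {n1 n2}.
by case: (cut p (f s.1) (g s.2) D); case: (cut p (f s.1) (g s.1) D);
  case: (cut p (f s.1) (f s.2) D); case: (cut p (f s.2) (g s.2) D);
  case: (cut p (g s.1) (g s.2) D).
Qed.

Lemma link_cone (C D : seq (T * T)) A p c :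
  closed_chain C -> supported A C -> closed_chain D -> supported (predC A) D ->
  A p -> A c -> all (fun s => ~~ cut c s.1 s.2 D) C -> link p C D = false.
Proof.
move=> cC sC cD sD Ap Ac nc; rewrite (link_apex cC sC cD sD Ap Ac) /link.
by rewrite big_seq big1 // => s sC'; apply/negbTE/(allP nc).
Qed.

End Linking.

(** * General position *)

Section Perturbation.
Variable R : realType.

(** The moment curve: distinct points on it are in general position. *)
Definition moment (u : R) : 'rV[R]_3 := \row_k u ^+ k.+1.

Lemma cx_moment u : cx (moment u) = u.
Proof. by rewrite /cx mxE inordK // expr1. Qed.
Lemma cy_moment u : cy (moment u) = u ^+ 2.
Proof. by rewrite /cy mxE inordK. Qed.
Lemma cz_moment u : cz (moment u) = u ^+ 3.
Proof. by rewrite /cz mxE inordK. Qed.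
Definition momentE := (cx_moment, cy_moment, cz_moment).

Lemma orient_moment a b c d :
  orient (moment a) (moment b) (moment c) (moment d) =
  (b - a) * (c - a) * (d - a) * (c - b) * (d - b) * (d - c).
Proof. by rewrite /orient !momentE; ring. Qed.

Lemma orient_moment_neq0 a b c d : uniq [:: a; b; c; d] ->
  orient (moment a) (moment b) (moment c) (moment d) != 0.
Proof.
rewrite orient_moment /= !inE !negb_or -!andbA => /and5P[ab ac ad bc /and3P[bd cd _]].
by rewrite !mulf_neq0 // subr_eq0 eq_sym.
Qed.

Lemma orient_scale (k : R) a b c d :
  orient (k *: a) (k *: b) (k *: c) (k *: d) = k ^+ 3 * orient a b c d.
Proof. by rewrite /orient /cx /cy /cz !mxE; ring. Qed.

Lemma norm_moment (u : R) : 0 <= u <= 1 -> `|moment u| <= 1.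
Proof.
move=> /andP[u0 u1]; change (mx_norm (moment u) <= 1).
have [->//|/mx_norm_neq0[i ->]] := eqVneq (mx_norm (moment u)) 0.
by rewrite mxE ger0_norm ?exprn_ge0 // exprn_ile1.
Qed.

Definition perturb (T : Type) (x : T -> 'rV[R]_3) (rho : T -> R) tau t :=
  x t + tau *: moment (rho t).

(** The orientation is a cubic polynomial in tau, and its leading coefficient
    is the orientation of the four directions. *)
Lemma orient_perturb (a b c d a' b' c' d' : 'rV[R]_3) : exists c0 c1 c2 : R,
  forall tau, orient (a + tau *: a') (b + tau *: b') (c + tau *: c') (d + tau *: d') =
  (c0 + c1 * tau + c2 * tau ^+ 2 + orient a' b' c' d' * tau ^+ 3).
Proof.
pose f tau := orient (a + tau *: a') (b + tau *: b') (c + tau *: c') (d + tau *: d').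
(* The other coefficients are recovered from the values at 0, 1 and -1. *)
exists (f 0), ((f 1 - f (- 1)) / 2 - orient a' b' c' d'), ((f 1 + f (- 1)) / 2 - f 0).
by move=> tau; rewrite /f /orient /cx /cy /cz !mxE; field.
Qed.

Lemma finite_bad_perturbations (a b c d a' b' c' d' : 'rV[R]_3) :
  orient a' b' c' d' != 0 ->
  finite_set [set tau | orient (a + tau *: a') (b + tau *: b') (c + tau *: c')
     (d + tau *: d') = 0].
Proof.
move=> nz; have [c0 [c1 [c2 E]]] := orient_perturb a b c d a' b' c' d'.
pose p := Poly [:: c0; c1; c2; orient a' b' c' d'].
have p0 : p != 0.
  apply/eqP => /(congr1 (fun q : {poly R} => q`_3)); rewrite coef_Poly coef0 /=.
  exact/eqP.
have pE tau : p.[tau] = orient (a + tau *: a') (b + tau *: b') (c + tau *: c')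
     (d + tau *: d').
  by rewrite E /p horner_Poly /=; ring.
apply: contrapT => /(@infinite_set_fset _ _ (size p))[B BA sB].
have Broot : all (root p) (finmap.enum_fset B)
  by apply/allP => tau /BA /= tB; rewrite /root pE tB.
by have := max_poly_roots p0 Broot (finmap.fset_uniq B); rewrite ltnNge sB.
Qed.

(** Each quadruple of labels excludes finitely many tau by
    finite_bad_perturbations, and the interval is not countable. *)
Lemma generic_perturbation (T : countType) (x : T -> 'rV[R]_3) (rho : T -> R)
    (delta : R) : injective rho -> 0 < delta ->
  exists2 tau, 0 < tau < delta & generic (perturb x rho tau).
Proof.
move=> rho_inj delta0.
pose bad (q : T * T * T * T) := let: (a, b, c, d) := q in
  [set tau | uniq [:: a; b; c; d] /\
    orient (perturb x rho tau a) (perturb x rho tau b) (perturb x rho tau c)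
      (perturb x rho tau d) = 0].
have bad_count : countable (\bigcup_(q in [set: T * T * T * T]) bad q).
  apply: bigcup_countable => // -[[[a b] c] d] _.
  apply: finite_set_countable; have [U|nU] := boolP (uniq [:: a; b; c; d]).
    have nz : orient (moment (rho a)) (moment (rho b)) (moment (rho c))
        (moment (rho d)) != 0.
      apply: orient_moment_neq0.
      by rewrite -[[:: _; _; _; _]]/(map rho [:: a; b; c; d]) map_inj_uniq.
    apply: sub_finite_set (finite_bad_perturbations (x a) (x b) (x c) (x d) nz).
    by move=> tau [].
  apply: sub_finite_set (finite_set0 _) => tau [U].
  by rewrite U in nU.
have [tau [tau_gt0 tau_ok]] : exists tau, 0 < tau < delta /\
    ~ (\bigcup_(q in [set: T * T * T * T]) bad q) tau.
  apply: contrapT => no; have : lebesgue_measure (`]0, delta[ : set R) = 0.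
    apply: countable_lebesgue_measure0; apply: sub_countable bad_count.
    apply: subset_card_le => tau /=; rewrite in_itv /= => tauI.
    by apply: contrapT => nbad; apply: no; exists tau.
  rewrite lebesgue_measure_itv /= lte_fin delta0 oppr0 adde0 => -[] d0.
  by rewrite d0 ltxx in delta0.
exists tau => // a b c d U; apply/eqP => E; apply: tau_ok.
by exists (a, b, c, d).
Qed.

End Perturbation.

(** * The linking parity of the pairs of cycles that miss an edge *)

(** The points that subdivide the edges: inl (false, i) is the red vertex i,
    inl (true, j) the blue vertex j, and inr (e, l) the point number l on the
    edge e. *)
Definition graph_point := ((bool * nat) + (nat * nat * nat))%type.

(** The labels inl n are put on the moment curve: they serve as apices of
    cones and as vertices of a straight copy of the graph.  The labels
    inr ((0, 0), u) are points of the given graph, and inr ((k.+1, r), u) is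
    the position of u at step r of the contraction number k. *)
Definition label := (nat + (nat * nat) * graph_point)%type.

Definition apex (n : nat) : label := inl n.
Definition red (i : nat) : label := inl (2 + i)%N.
Definition blue (j : nat) : label := inl (6 + j)%N.

(** At step 0 the label is that of the graph point itself, whatever the
    contraction. *)
Definition grid (k r : nat) (u : graph_point) : label :=
  inr (if r is 0%N then (0%N, 0%N) else (k.+1, r), u).
Definition on_graph : graph_point -> label := grid 0 0.

Definition path_point (M : nat) (e : nat * nat) (l : nat) : graph_point :=
  if l == 0%N then inl (false, e.1) else
  if l == M then inl (true, e.2) else inr (e, l).

Definition edge_path (M : nat) (e : nat * nat) : seq (graph_point * graph_point) :=
  [seq (path_point M e l, path_point M e l.+1) | l <- iota 0 M].

Definition cycle_path (M : nat) (c : seq (nat * nat)) :=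
  flatten [seq edge_path M e | e <- c].

Lemma edge_path_boundary M e (F : graph_point -> bool) : (0 < M)%N ->
  \xor_(s <- edge_path M e) (F s.1 (+) F s.2) =
  F (inl (false, e.1)) (+) F (inl (true, e.2)).
Proof.
move=> M0; rewrite /edge_path big_map.
have T n : \xor_(l <- iota 0 n) (F (path_point M e l) (+) F (path_point M e l.+1)) =
    F (path_point M e 0) (+) F (path_point M e n).
  elim: n => [|n IH]; first by rewrite big_nil addbb.
  rewrite -addn1 iotaD big_cat /= big_seq1 IH add0n addn1.
  by rewrite addbA addbK.
by rewrite T /path_point eqxx; case: eqP M0 => [->//|_]; rewrite eqxx.
Qed.

Definition complete_cycle (I J : seq nat) := [seq (i, j) | i <- I, j <- J].

(** The nine pairs of complementary 4-cycles that miss the edge (0, 0): the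
    first cycle contains the red vertex 0 and the second one the blue
    vertex 0. *)
Definition avoiding_pairs : seq (seq (nat * nat) * seq (nat * nat)) :=
  [seq (complete_cycle [:: 0; i] (rem l [:: 1; 2; 3]),
        complete_cycle (rem i [:: 1; 2; 3]) [:: 0; l])
  | i <- [:: 1; 2; 3], l <- [:: 1; 2; 3]]%N.

Definition edge_pairs (r : seq (seq (nat * nat) * seq (nat * nat))) :=
  flatten [seq [seq (e, e') | e <- k.1, e' <- k.2] | k <- r].

Definition sort_pair (q : (nat * nat) * (nat * nat)) :=
  if (q.1.1 < q.2.1)%N then q else (q.2, q.1).

Lemma xor_edge_pairs r (F : nat * nat -> nat * nat -> bool) :
  \xor_(k <- r) \xor_(e <- k.1) \xor_(e' <- k.2) F e e' =
  \xor_(q <- edge_pairs r) F q.1 q.2.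
Proof.
by rewrite big_flatten /= big_map; apply: eq_bigr => k _; rewrite big_allpairs.
Qed.

Lemma closed_cycle_path M c : (0 < M)%N ->
  all (fun n => ~~ odd (count_mem n (unzip1 c))) (unzip1 c) ->
  all (fun n => ~~ odd (count_mem n (unzip2 c))) (unzip2 c) ->
  closed_chain (cycle_path M c).
Proof.
move=> M0 ev1 ev2 F; rewrite /cycle_path big_flatten /= big_map.
under eq_bigr => e _ do rewrite edge_path_boundary //.
rewrite big_split /=.
have := xor_even (fun i => F (inl (false, i))) ev1; rewrite big_map => ->.
by have := xor_even (fun i => F (inl (true, i))) ev2; rewrite big_map => ->.
Qed.

(** Tells a cycle on the red vertices I and the blue vertices J from the
    cycle on the other vertices.  On labels that neither of them visits the
    value is arbitrary. *)
Definition side (I J : seq nat) (t : label) : bool :=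
  match t with
  | inl n => if (n < 6)%N then (n - 2)%N \in I else (n - 6)%N \in J
  | inr (_, inl (b, n)) => n \in if b then J else I
  | inr (_, inr (e, _)) => e.1 \in I
  end.

(** The path through the straight copy that closes up an edge.  Around a cycle
    the segments between a vertex and its copy occur twice and cancel, leaving
    the straight copy of the cycle. *)
Definition tails (e : nat * nat) : seq (label * label) :=
  [:: (on_graph (inl (false, e.1)), red e.1); (red e.1, blue e.2);
      (blue e.2, on_graph (inl (true, e.2)))].

Definition tails_cycle (c : seq (nat * nat)) := flatten [seq tails e | e <- c].

Definition straight_cycle (c : seq (nat * nat)) : seq (label * label) :=
  [seq (red e.1, blue e.2) | e <- c].

Definition loop M e := map_chain on_graph (edge_path M e) ++ tails e.

Lemma closed_loop M e : (0 < M)%N -> closed_chain (loop M e).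
Proof.
move=> M0 F; rewrite big_cat big_map /= (edge_path_boundary e (F \o on_graph) M0).
rewrite /= !big_cons big_nil /=.
by case: (F (red _)); case: (F (blue _)); case: (F _); case: (F _).
Qed.

Lemma supported_edge_path (A : pred label) (f : graph_point -> label) M e :
  (forall l, A (f (path_point M e l))) -> supported A (map_chain f (edge_path M e)).
Proof. by move=> H; apply/allP => s /mapP[u /mapP[l _ ->] ->] /=; rewrite !H. Qed.

Lemma supported_flatten (I : eqType) (U : Type) (A : pred U) (r : seq I) (F : I -> seq (U * U)) :
  {in r, forall i, supported A (F i)} -> supported A (flatten [seq F i | i <- r]).
Proof.
elim: r => //= i r IH H; rewrite /supported all_cat; apply/andP; split.
  by apply: H; rewrite mem_head.
by apply: IH => j jr; apply: H; rewrite inE jr orbT.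
Qed.

Definition small_edge (e : nat * nat) := (e.1 < 4)%N && (e.2 < 4)%N.

Lemma side_inl I J n : side I J (inl n) =
  if (n < 6)%N then (n - 2)%N \in I else (n - 6)%N \in J.
Proof. by []. Qed.

Lemma side_red I J i : (i < 4)%N -> side I J (red i) = (i \in I).
Proof. by move=> i4; rewrite side_inl (ltn_add2l 2 i 4) i4 addKn. Qed.

Lemma side_blue I J j : side I J (blue j) = (j \in J).
Proof. by rewrite side_inl ltnNge leq_addr addKn. Qed.

Lemma side_path I J k r M e l :
  e.1 \in I -> e.2 \in J -> side I J (grid k r (path_point M e l)).
Proof. by move=> eI eJ; rewrite /path_point; do 2?case: eqP => _ //=. Qed.

Lemma side_pathN I J k r M e l :
  e.1 \notin I -> e.2 \notin J -> ~~ side I J (grid k r (path_point M e l)).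
Proof. by move=> eI eJ; rewrite /path_point; do 2?case: eqP => _ //=. Qed.

Lemma supported_tails I J e : small_edge e -> e.1 \in I -> e.2 \in J ->
  supported (side I J) (tails e).
Proof.
case/andP=> e4 _ eI eJ; rewrite /supported /tails.
have r : side I J (red e.1) by rewrite side_red.
have b : side I J (blue e.2) by rewrite side_blue.
by apply/and4P; split => //; apply/andP; split.
Qed.

Lemma supported_tailsN I J e : small_edge e -> e.1 \notin I -> e.2 \notin J ->
  supported (predC (side I J)) (tails e).
Proof.
case/andP=> e4 _ eI eJ; rewrite /supported /tails.
have r : ~~ side I J (red e.1) by rewrite side_red.
have b : ~~ side I J (blue e.2) by rewrite side_blue.
by apply/and4P; split => //; apply/andP; split.
Qed.

Lemma supported_loop I J M e : small_edge e -> e.1 \in I -> e.2 \in J ->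
  supported (side I J) (loop M e).
Proof.
move=> e4 eI eJ; rewrite /supported all_cat; apply/andP; split.
  by apply: supported_edge_path => l; apply: side_path.
exact: supported_tails.
Qed.

Lemma supported_loopN I J M e : small_edge e -> e.1 \notin I -> e.2 \notin J ->
  supported (predC (side I J)) (loop M e).
Proof.
move=> e4 eI eJ; rewrite /supported all_cat; apply/andP; split.
  by apply: supported_edge_path => l; apply: side_pathN.
exact: supported_tailsN.
Qed.

Definition apexes := pred2 (apex 0) (apex 1).

Lemma apexes_tails e : supported (predC apexes) (tails e).
Proof. by []. Qed.

Lemma apexes_loop M e : supported (predC apexes) (loop M e).
Proof.
rewrite /supported all_cat; apply/andP; split; last exact: apexes_tails.
exact: supported_edge_path.
Qed.

Section Parity.
Variables (R : realFieldType) (x : label -> 'rV[R]_3) (M : nat).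
Hypothesis (x_gen : generic x) (M_gt0 : (0 < M)%N).

Let L C D := link x (apex 0) C D.

Lemma link_loops e e' : small_edge e -> small_edge e' ->
  e.1 != e'.1 -> e.2 != e'.2 -> L (loop M e) (loop M e') = L (loop M e') (loop M e).
Proof.
move=> e4 e4' n1 n2.
apply: (link_comm x_gen (A := side [:: e.1] [:: e.2]) (q := apex 1)) => //;
  try exact: closed_loop; try exact: apexes_loop.
- by apply: supported_loop; rewrite ?mem_head.
- by apply: supported_loopN; rewrite // inE eq_sym.
Qed.

(** Modulo 2, an edge path is the sum of its loop and of the tails. *)
Lemma link_paths e e' :
  L (map_chain on_graph (edge_path M e)) (map_chain on_graph (edge_path M e')) =
  L (loop M e) (loop M e') (+) L (loop M e) (tails e') (+)
  (L (tails e) (loop M e') (+) L (tails e) (tails e')).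
Proof.
rewrite /L /loop !link_cat !link_catr.
move: (link _ _ _ (map_chain _ _)) (link _ _ (map_chain _ _) (tails e')).
move: (link _ _ (tails e) (map_chain _ _)) (link _ _ (tails e) (tails e')).
by do 4!case.
Qed.

(** Every vertex of a cycle is an end of an even number of its edges. *)
Lemma xor_tails_cycle c (F : label * label -> bool) :
  all (fun n => ~~ odd (count_mem n (unzip1 c))) (unzip1 c) ->
  all (fun n => ~~ odd (count_mem n (unzip2 c))) (unzip2 c) ->
  \xor_(s <- tails_cycle c) F s = \xor_(s <- straight_cycle c) F s.
Proof.
move=> ev1 ev2; rewrite big_flatten /= !big_map.
under eq_bigr => e _ do rewrite /tails !big_cons big_nil addbF.
rewrite !big_split /=.
have := xor_even (fun i => F (on_graph (inl (false, i)), red i)) ev1.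
rewrite big_map => ->.
have := xor_even (fun i => F (blue i, on_graph (inl (true, i)))) ev2.
by rewrite big_map => ->; rewrite addFb addbF.
Qed.

Lemma closed_straight_cycle c :
  all (fun n => ~~ odd (count_mem n (unzip1 c))) (unzip1 c) ->
  all (fun n => ~~ odd (count_mem n (unzip2 c))) (unzip2 c) ->
  closed_chain (straight_cycle c).
Proof.
move=> ev1 ev2 F; rewrite big_map big_split /=.
have := xor_even (fun i => F (red i)) ev1; rewrite big_map => ->.
by have := xor_even (fun i => F (blue i)) ev2; rewrite big_map => ->.
Qed.

Definition even_cycle (c : seq (nat * nat)) :=
  [&& all small_edge c,
      all (fun n => ~~ odd (count_mem n (unzip1 c))) (unzip1 c) &
      all (fun n => ~~ odd (count_mem n (unzip2 c))) (unzip2 c)].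

Lemma link_tails_loop c e' : even_cycle c -> small_edge e' ->
  e'.1 \notin unzip1 c -> e'.2 \notin unzip2 c ->
  \xor_(e <- c) L (tails e) (loop M e') = \xor_(e <- c) L (loop M e') (tails e).
Proof.
move=> /and3P[c4 ev1 ev2] e4' n1 n2.
rewrite /L -link_flatten -link_flattenr -/(tails_cycle c).
have cl : closed_chain (tails_cycle c).
  by move=> F; rewrite xor_tails_cycle //; apply: closed_straight_cycle.
apply: (link_comm x_gen (A := side (unzip1 c) (unzip2 c)) (q := apex 1)) => //.
- apply: supported_flatten => e ec; apply: supported_tails; first exact: (allP c4).
    exact: map_f.
  exact: map_f.
- exact: closed_loop.
- exact: supported_loopN.
- by apply: supported_flatten => e _; apply: apexes_tails.
- exact: apexes_loop.
Qed.

Lemma link_cycle_paths c d : even_cycle c -> even_cycle d ->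
  all (fun e => (e.1 \notin unzip1 c) && (e.2 \notin unzip2 c)) d ->
  L (map_chain on_graph (cycle_path M c)) (map_chain on_graph (cycle_path M d)) =
  L (map_chain on_graph (cycle_path M d)) (map_chain on_graph (cycle_path M c)).
Proof.
have S (A : pred label) b : (forall e l, e \in b -> A (on_graph (path_point M e l))) ->
    supported A (map_chain on_graph (cycle_path M b)).
  move=> H; apply/allP => _ /mapP[s /flatten_mapP[e eb /mapP[l _ ->]] ->] /=.
  by rewrite !H.
move=> /and3P[_ c1 c2] /and3P[_ d1 d2] cd.
apply: (link_comm x_gen (A := side (unzip1 c) (unzip2 c)) (q := apex 1)) => //.
- exact/closed_map_chain/closed_cycle_path.
- by apply: S => e l ec; apply: side_path; apply: map_f.
- exact/closed_map_chain/closed_cycle_path.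
- by apply: S => e l ed; have /andP[? ?] := allP cd e ed; apply: side_pathN.
- exact: S.
- exact: S.
Qed.

Lemma avoiding_pairs_even : all (fun k => even_cycle k.1 && even_cycle k.2) avoiding_pairs.
Proof. by vm_compute. Qed.

Lemma avoiding_pairs_disjoint : all (fun q => [&& small_edge q.1, small_edge q.2,
  q.1.1 != q.2.1 & q.1.2 != q.2.2]) (edge_pairs avoiding_pairs).
Proof. by vm_compute. Qed.

Lemma avoiding_pairs_disjoint_cycles : all (fun k => all (fun e' =>
  (e'.1 \notin unzip1 k.1) && (e'.2 \notin unzip2 k.1)) k.2) avoiding_pairs.
Proof. by vm_compute. Qed.

Lemma avoiding_pairs_disjoint_cycles_sym : all (fun k => all (fun e' =>
  (e'.1 \notin unzip1 k.2) && (e'.2 \notin unzip2 k.2)) k.1) avoiding_pairs.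
Proof. by vm_compute. Qed.

(** This parity is why the sum of the nine linking numbers is an invariant:
    two disjoint edges are separated by an even number of the nine pairs. *)
Lemma edge_pairs_even : let r := [seq sort_pair q | q <- edge_pairs avoiding_pairs] in
  all (fun q => ~~ odd (count_mem q r)) r.
Proof. by vm_compute. Qed.

Lemma swapped_pairs_even :
  let r := edge_pairs avoiding_pairs ++ [seq (q.2, q.1) | q <- edge_pairs avoiding_pairs] in
  all (fun q => ~~ odd (count_mem q r)) r.
Proof. by vm_compute. Qed.

(** Expand by link_paths.  The terms with two loops cancel: they are symmetric
    because loops are closed, and each pair of edges occurs an even number of
    times.  So do the terms with one loop, which become symmetric once the
    tails around a cycle are added up to a closed chain.  The terms with tails
    on both sides give the straight copy. *)
Lemma link_paths_straight :
  \xor_(k <- avoiding_pairs) L (map_chain on_graph (cycle_path M k.1))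
                       (map_chain on_graph (cycle_path M k.2)) =
  \xor_(k <- avoiding_pairs) L (straight_cycle k.1) (straight_cycle k.2).
Proof.
have E k : L (map_chain on_graph (cycle_path M k.1))
             (map_chain on_graph (cycle_path M k.2)) =
    \xor_(e <- k.1) \xor_(e' <- k.2)
      L (map_chain on_graph (edge_path M e)) (map_chain on_graph (edge_path M e')).
  rewrite /map_chain /cycle_path !map_flatten -!map_comp /L link_flatten.
  by apply: eq_bigr => e _; rewrite link_flattenr.
under eq_bigr => k _ do rewrite E.
under eq_bigr => k _ do under eq_bigr => e _ do under eq_bigr => e' _ do rewrite link_paths.
under eq_bigr => k _ do under eq_bigr => e _ do rewrite !big_split /=.
under eq_bigr => k _ do rewrite !big_split /=.
rewrite !big_split /=.
have -> : \xor_(k <- avoiding_pairs) \xor_(e <- k.1) \xor_(e' <- k.2)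
    L (loop M e) (loop M e') = false.
  rewrite xor_edge_pairs -[RHS](xor_even (fun q => L (loop M q.1) (loop M q.2)) edge_pairs_even).
  rewrite big_map big_seq [RHS]big_seq; apply: eq_bigr => q qs.
  have /and4P[q14 q24 n1 n2] := allP avoiding_pairs_disjoint q qs.
  by rewrite /sort_pair; case: ifP => //= _; apply: link_loops.
rewrite addFb addbA.
have -> : \xor_(k <- avoiding_pairs) \xor_(e <- k.1) \xor_(e' <- k.2) L (tails e) (loop M e') =
    \xor_(k <- avoiding_pairs) \xor_(e <- k.1) \xor_(e' <- k.2) L (loop M e') (tails e).
  rewrite big_seq [RHS]big_seq; apply: eq_bigr => k ks.
  rewrite exchange_big [RHS]exchange_big /= big_seq [RHS]big_seq.
  apply: eq_bigr => e' e'k; apply: link_tails_loop.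
  - by have /andP[] := allP avoiding_pairs_even k ks.
  - by have /andP[_ /and3P[/allP/(_ e' e'k)]] := allP avoiding_pairs_even k ks.
  - by have /allP/(_ e' e'k)/andP[] := allP avoiding_pairs_disjoint_cycles k ks.
  - by have /allP/(_ e' e'k)/andP[] := allP avoiding_pairs_disjoint_cycles k ks.
rewrite (xor_edge_pairs avoiding_pairs (fun e e' => L (loop M e') (tails e))) xor_edge_pairs.
have -> : \xor_(q <- edge_pairs avoiding_pairs) L (loop M q.1) (tails q.2) (+)
    \xor_(q <- edge_pairs avoiding_pairs) L (loop M q.2) (tails q.1) = false.
  rewrite -[RHS](xor_even (fun q => L (loop M q.1) (tails q.2)) swapped_pairs_even).
  by rewrite [RHS]big_cat; congr (_ (+) _); rewrite [RHS]big_map.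
rewrite addFb big_seq [RHS]big_seq; apply: eq_bigr => k ks.
have /andP[/and3P[_ ev1 ev2] /and3P[_ ev1' ev2']] := allP avoiding_pairs_even k ks.
transitivity (L (tails_cycle k.1) (tails_cycle k.2)).
  by rewrite /L link_flatten; apply: eq_bigr => e _; rewrite link_flattenr.
rewrite /L /link xor_tails_cycle //; apply: eq_bigr => s _.
by rewrite /cut xor_tails_cycle.
Qed.

(** The sign of a Vandermonde determinant is the parity of the number of
    inversions. *)
Definition moment_sign (a b c d : nat) : bool :=
  ~~ ((b < a) (+) (c < a) (+) (d < a) (+) (c < b) (+) (d < b) (+) (d < c))%N.

Definition moment_hit (a b c d e : nat) : bool :=
  uniq [:: a; b; c; d; e] &&
  pierceb (moment_sign a b c d) (moment_sign a b c e) (moment_sign a b d e)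
    (moment_sign b c d e) (moment_sign c a d e).

Hypothesis x_moment : forall a b c d : nat, uniq [:: a; b; c; d] ->
  pos (x (inl a)) (x (inl b)) (x (inl c)) (x (inl d)) = moment_sign a b c d.

Lemma hit_moment a b c d e :
  hit x (inl a) (inl b) (inl c) (inl d) (inl e) = moment_hit a b c d e.
Proof.
rewrite /hit /moment_hit.
have -> : uniq [:: inl a : label; inl b; inl c; inl d; inl e] = uniq [:: a; b; c; d; e].
  by rewrite -(map_inj_uniq (f := inl : nat -> label)) // => ? ? [].
by apply: andb_id2l => /uniq_quadruples[? ? ? ? ?]; rewrite /pierce !x_moment.
Qed.

Lemma xor_foldr (I : Type) (r : seq I) (F : I -> bool) :
  \xor_(i <- r) F i = foldr (fun i b => F i (+) b) false r.
Proof. by elim: r => [|i r IH]; rewrite ?big_nil // big_cons IH. Qed.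

Lemma straight_parity :
  \xor_(k <- avoiding_pairs) L (straight_cycle k.1) (straight_cycle k.2) = true.
Proof.
have E k : L (straight_cycle k.1) (straight_cycle k.2) =
    \xor_(e <- k.1) \xor_(e' <- k.2)
      moment_hit 0 (2 + e.1) (6 + e.2) (2 + e'.1) (6 + e'.2).
  rewrite /L /link big_map; apply: eq_bigr => e _; rewrite /cut big_map.
  by apply: eq_bigr => e' _; rewrite -hit_moment.
under eq_bigr => k _ do rewrite E.
by rewrite xor_edge_pairs xor_foldr; vm_compute.
Qed.

(** Any family of paths can replace the edges of the straight copy without
    changing the sum of the nine linking numbers. *)
Theorem link_parity :
  \xor_(k <- avoiding_pairs) L (map_chain on_graph (cycle_path M k.1))
                       (map_chain on_graph (cycle_path M k.2)) = true.
Proof. by rewrite link_paths_straight straight_parity. Qed.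

End Parity.

(** * Polygonal approximation of paths and of contractions *)

Section Approximation.
Variable R : realType.

Lemma convex_close (V : normedModType R) (P a b c : V) (u v w rho : R) :
  0 <= u -> 0 <= v -> 0 <= w -> u + v + w = 1 ->
  `|a - P| <= rho -> `|b - P| <= rho -> `|c - P| <= rho ->
  `|u *: a + v *: b + w *: c - P| <= rho.
Proof.
move=> u0 v0 w0 uvw aP bP cP.
have -> : u *: a + v *: b + w *: c - P = u *: (a - P) + v *: (b - P) + w *: (c - P).
  rewrite !scalerBr [X in _ = X + _]addrACA -opprD [RHS]addrACA -opprD -!scalerDl uvw.
  by rewrite scale1r.
have -> : rho = u * rho + v * rho + w * rho by rewrite -!mulrDl uvw mul1r.
apply: le_trans (ler_normD _ _) _; apply: lerD; last by rewrite normrZ ger0_norm ?ler_wpM2l.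
apply: le_trans (ler_normD _ _) _.
by apply: lerD; rewrite normrZ ger0_norm ?ler_wpM2l.
Qed.

(** The common point of the segment and the triangle would be within rho of
    both P and Q. *)
Lemma hit_far (T : eqType) (x : T -> 'rV[R]_3) a b c d e (P Q : 'rV[R]_3) rho :
  generic x -> `|x a - P| <= rho -> `|x b - P| <= rho -> `|x c - P| <= rho ->
  `|x d - Q| <= rho -> `|x e - Q| <= rho -> 2 * rho < `|P - Q| ->
  hit x a b c d e = false.
Proof.
move=> x_gen aP bP cP dQ eQ; apply: contraTF => /(hit_meet x_gen).
case=> u [v [w [s [t [u0 v0 w0 uvw [s0 t0 st E]]]]]]; rewrite -leNgt.
have H1 := convex_close u0 v0 w0 uvw aP bP cP.
have H2 := convex_close s0 t0 (lexx 0) (etrans (addr0 _) st) dQ eQ eQ.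
rewrite scale0r addr0 -E in H2.
set Z := u *: x a + v *: x b + w *: x c in H1 H2.
rewrite mulr2n mulrDl mul1r (le_trans (ler_distD Z P Q)) //.
by apply: lerD => //; rewrite distrC.
Qed.

(** Heine-Cantor, with only one of the two points required to lie in the
    compact set. *)
Lemma compact_uniform (X : pseudoMetricType R) (V : normedModType R) (F : X -> V)
    (K : set X) (eps : R) :
  compact K -> continuous F -> 0 < eps ->
  exists2 d : R, 0 < d & forall p q, K p -> ball p d q -> `|F p - F q| < eps.
Proof.
move=> /compact_near_coveringP cK cF eps0.
pose good (d : R) p := forall q, ball p d q -> `|F p - F q| < eps.
have cov : \forall d \near 0^'+, K `<=` good d.
  apply: cK => p Kp.
  have /cvgrPdist_lt/(_ _ (divr_gt0 eps0 (ltr0n R 2))) := cF p.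
  case/nbhs_ballP => r /= r0 rF.
  exists (ball p (r / 2), [set d : R | 0 < d < r / 2]).
    split; first by apply: nbhsx_ballx; rewrite divr_gt0.
    near=> d; apply/andP; split; near: d; first exact: nbhs_right_gt.
    by apply: nbhs_right_lt; rewrite divr_gt0.
  case=> q d [/= pq /andP[d0 dr]] q' qq'.
  have r2 : r / 2 < r by rewrite ltr_pdivrMr // ltr_pMr // ltr1n.
  have := rF q (le_ball (ltW r2) pq).
  have : ball p r q' by rewrite [r]splitr; apply: ball_triangle pq (le_ball (ltW dr) qq').
  move=> /rF /= H1 H2.
  by rewrite [eps]splitr (le_lt_trans (ler_distD (F p) _ _)) // ltrD // distrC.
have [d [d0 dK]] : exists d : R, 0 < d /\ K `<=` good d.
  near (0 : R)^'+ => d; exists d; split; near: d => //.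
  exact: nbhs_right_gt.
by exists d => // p q Kp; apply: dK.
Unshelve. all: by end_near. Qed.

Lemma compact_dist_gt0 (X : topologicalType) (V : normedModType R) (F G : X -> V)
    (K : set X) : compact K -> continuous F -> continuous G ->
  (forall p, K p -> F p != G p) ->
  exists2 d : R, 0 < d & forall p, K p -> d <= `|F p - G p|.
Proof.
move=> cK cF cG FG; have [->|/set0P K0] := eqVneq K set0.
  by exists 1.
have cD : continuous (fun p => `|F p - G p|).
  by move=> p; apply: (@continuous_comp _ _ _ (fun p => F p - G p) Num.norm);
    [apply: cvgB; [exact: cF|exact: cG] | exact: norm_continuous].
have [c cK' cmin] := compact_EVT_min K0 cK (continuous_subspaceT cD).
exists `|F c - G c|; last by move=> p Kp; apply: cmin; rewrite ?inE.
by rewrite normr_gt0 subr_eq0 FG // -in_setE.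
Qed.

Lemma common_scale (I : eqType) (r : seq I) (P : I -> R -> Prop) :
  (forall i d d', 0 < d' <= d -> P i d -> P i d') ->
  (forall i, i \in r -> exists2 d, 0 < d & P i d) ->
  exists2 d, 0 < d & forall i, i \in r -> P i d.
Proof.
move=> Pm; elim: r => [|i r IH] Pr; first by exists 1.
have [d d0 dr] := IH (fun j jr => Pr j (mem_behead (s := i :: r) jr)).
have [d' d'0 d'i] := Pr i (mem_head i r).
have m0 : 0 < Num.min d d' by rewrite lt_min d0.
exists (Num.min d d') => // j; rewrite inE => /predU1P[->|jr].
  by apply: Pm d'i; rewrite m0 ge_min lexx orbT.
by apply: Pm (dr j jr); rewrite m0 ge_min lexx.
Qed.

(** The cycle c shrinks to a point while avoiding d; H s y is the position of
    y at time s. *)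
Definition contracts_off (g : nat * nat -> R -> 'rV[R]_3) (c d : seq (nat * nat))
    (H : R -> 'rV[R]_3 -> 'rV[R]_3) :=
  [/\ forall e, continuous (fun p : R * R => H p.1 (g e p.2)),
      forall y, H 0 y = y,
      exists z, forall y, H 1 y = z &
      forall s t t' e e', 0 <= s <= 1 -> 0 <= t <= 1 -> 0 <= t' <= 1 ->
        e \in c -> e' \in d -> H s (g e t) != g e' t'].

Section Grid.
Variables (g : nat * nat -> R -> 'rV[R]_3) (A B : nat -> 'rV[R]_3).
Variables (H : nat -> R -> 'rV[R]_3 -> 'rV[R]_3) (std : nat -> 'rV[R]_3) (M : nat).
Hypotheses (g0 : forall e, g e 0 = A e.1) (g1 : forall e, g e 1 = B e.2).
Hypothesis (H0 : forall n y, H n 0 y = y).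
Hypothesis M_gt0 : (0 < M)%N.

Definition graph_position (u : graph_point) : 'rV[R]_3 :=
  match u with
  | inl (b, n) => if b then B n else A n
  | inr (e, l) => g e (l%:R / M%:R)
  end.

(** The positions before the perturbation into general position; M is the
    number of pieces of an edge and the number of steps of a contraction. *)
Definition label_position (t : label) : 'rV[R]_3 :=
  match t with
  | inl n => std n
  | inr ((0%N, _), u) => graph_position u
  | inr ((n.+1, r), u) => H n (r%:R / M%:R) (graph_position u)
  end.

Lemma graph_position_path e l : graph_position (path_point M e l) = g e (l%:R / M%:R).
Proof.
rewrite /path_point; case: eqP => [->|_] /=; first by rewrite mul0r g0.
by case: eqP => [->|_] //=; rewrite divff ?g1 // pnatr_eq0 -lt0n.
Qed.

Lemma label_position_grid n r u :
  label_position (grid n r u) = H n (r%:R / M%:R) (graph_position u).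
Proof. by case: r => [|r] //=; rewrite mul0r H0. Qed.

Lemma frac01 l : (l <= M)%N -> 0 <= (l%:R / M%:R : R) <= 1.
Proof. by move=> lM; rewrite divr_ge0 //= ler_pdivrMr ?ltr0n // mul1r ler_nat. Qed.

Lemma frac_next l : `|l%:R / M%:R - l.+1%:R / M%:R| <= M%:R^-1 :> R.
Proof.
rewrite -mulrBl normrM -natr1 opprD addrA subrr sub0r normrN normr1 mul1r.
by rewrite ger0_norm ?invr_ge0.
Qed.

Lemma frac_same l : `|l%:R / M%:R - l%:R / M%:R| <= M%:R^-1 :> R.
Proof. by rewrite subrr normr0 invr_ge0. Qed.

Variables (x : label -> 'rV[R]_3) (eps : R).
Hypotheses (x_gen : generic x) (eps_gt0 : 0 < eps).
Hypothesis x_close : forall t, `|x t - label_position t| <= eps.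

Definition fine_mesh (c : seq (nat * nat)) (F : R -> 'rV[R]_3 -> 'rV[R]_3) :=
  forall e s s' t t', e \in c -> 0 <= s <= 1 -> 0 <= s' <= 1 -> 0 <= t <= 1 ->
    0 <= t' <= 1 -> `|s - s'| <= M%:R^-1 -> `|t - t'| <= M%:R^-1 ->
    `|F s (g e t) - F s' (g e t')| < eps.

Variables (n : nat) (c d : seq (nat * nat)).
Hypothesis c_contr : contracts_off g c d (H n).
Hypotheses (c_even : even_cycle c) (d_even : even_cycle d).
Hypothesis cd_disj :
  all (fun e' => (e'.1 \notin unzip1 c) && (e'.2 \notin unzip2 c)) d.
Hypotheses (c_fine : fine_mesh c (H n)) (d_fine : fine_mesh d (fun _ y => y)).
(* The vertices of a small triangle are within 2 * eps of a point of the moving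
   cycle, and those of a small edge of d within 2 * eps of a point of d. *)
Hypothesis cd_far : forall s t t' e e', 0 <= s <= 1 -> 0 <= t <= 1 ->
  0 <= t' <= 1 -> e \in c -> e' \in d -> 5 * eps <= `|H n s (g e t) - g e' t'|.

(** The side of the cycle that moves; the apex and all later steps of the
    contractions are put on it. *)
Definition inner (t : label) : bool :=
  [|| t == apex 0, (if t is inr ((k, _), _) then k != 0%N else false)
    | side (unzip1 c) (unzip2 c) t].

Lemma close_to P t : `|P - label_position t| < eps -> `|x t - P| <= 2 * eps.
Proof.
move=> Pt; rewrite mulr2n mulrDl mul1r (le_trans (ler_distD (label_position t) _ _)) //.
by apply: lerD => //; rewrite distrC ltW.
Qed.

Lemma cut_small a a' a'' e s t : e \in c -> 0 <= s <= 1 -> 0 <= t <= 1 ->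
  `|H n s (g e t) - label_position a| < eps ->
  `|H n s (g e t) - label_position a'| < eps ->
  `|H n s (g e t) - label_position a''| < eps ->
  cut x a a' a'' (map_chain on_graph (cycle_path M d)) = false.
Proof.
move=> ec s01 t01 /close_to Ca /close_to Ca' /close_to Ca''.
rewrite /cut big_map big_seq big1 // => u /flatten_mapP[e' e'd /mapP[l]].
rewrite mem_iota add0n => /= lM -> {u}.
have l01 := frac01 (ltnW lM); have l101 := frac01 lM.
apply: (hit_far (P := H n s (g e t)) (Q := g e' (l%:R / M%:R))) Ca Ca' Ca'' _ _ _ => //.
- apply: close_to; rewrite /= graph_position_path.
  by apply: (d_fine (s := 0) (s' := 0)); rewrite ?frac_same // ?subrr ?normr0 ?invr_ge0
    ?lexx ?ler01.
- apply: close_to; rewrite /= graph_position_path.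
  by apply: (d_fine (s := 0) (s' := 0)); rewrite ?frac_next // ?subrr ?normr0 ?invr_ge0
    ?lexx ?ler01.
apply: lt_le_trans (cd_far s01 t01 l01 ec e'd).
by rewrite mulrA -natrM ltr_pM2r // ltr_nat.
Qed.

Lemma closed_even_cycle b : even_cycle b -> closed_chain (map_chain on_graph (cycle_path M b)).
Proof. by case/and3P=> _ ? ?; apply/closed_map_chain/closed_cycle_path. Qed.

Lemma inner_grid e r l : e \in c -> inner (grid n r (path_point M e l)).
Proof. by move=> ec; rewrite /inner side_path ?orbT // map_f. Qed.

(** Each step of the contraction sweeps small triangles only, which d misses;
    at the last step all the points are close together and a small cone
    remains. *)
Lemma link_contracted : link x (apex 0) (map_chain on_graph (cycle_path M c))
  (map_chain on_graph (cycle_path M d)) = false.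
Proof.
have cD := closed_even_cycle d_even.
have cC : closed_chain (cycle_path M c).
  by case/and3P: c_even => _ ? ?; apply: closed_cycle_path.
have sD : supported (predC inner) (map_chain on_graph (cycle_path M d)).
  apply/allP => _ /mapP[s /flatten_mapP[e ed /mapP[l _ ->]] ->] /=.
  have /andP[n1 n2] := allP cd_disj e ed.
  have N l' : ~~ inner (on_graph (path_point M e l')).
    by rewrite /inner /on_graph (negPf (side_pathN _ _ _ _ n1 n2)).
  by rewrite !N.
have A0 : inner (apex 0) by rewrite /inner eqxx.
have step r : (r <= M)%N -> link x (apex 0) (map_chain on_graph (cycle_path M c))
    (map_chain on_graph (cycle_path M d)) =
  link x (apex 0) (map_chain (grid n r) (cycle_path M c))
    (map_chain on_graph (cycle_path M d)).
  elim: r => // r IH rM; rewrite IH 1?ltnW //.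
  apply: (link_homotopic x_gen cC cD sD A0).
    by apply/allP => _ /flatten_mapP[e ec /mapP[l _ ->]]; rewrite /= !inner_grid.
  apply/allP => u /flatten_mapP[e ec /mapP[l]]; rewrite mem_iota add0n => /= lM -> {u}.
  have [l01 l101] := (frac01 (ltnW lM), frac01 lM).
  have [r01 r101] := (frac01 (ltnW rM), frac01 rM).
  apply/andP; split; apply/negbT;
    apply: (@cut_small _ _ _ e (r%:R / M%:R) (l%:R / M%:R)) => //;
    rewrite (label_position_grid n r, label_position_grid n r.+1) graph_position_path;
    apply: c_fine => //; rewrite ?frac_same ?frac_next //.
rewrite (step M) //; apply: (link_cone x_gen _ _ cD sD A0 (c := grid n M (inl (false, 0%N)))).
- exact: closed_map_chain.
- by apply/allP => _ /mapP[_ /flatten_mapP[e ec /mapP[l _ ->]] ->]; rewrite !inner_grid.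
- by rewrite /inner; case: (M) M_gt0.
- have [_ _ [z Hz] _] := c_contr.
  have Mz u : label_position (grid n M u) = z.
    by rewrite label_position_grid divff ?Hz // pnatr_eq0 -lt0n.
  apply/allP => _ /mapP[s /flatten_mapP[e ec _] ->] /=; apply/negbT.
  by apply: (@cut_small _ _ _ e 1 0) => //; rewrite ?lexx ?ler01 // ?Mz ?Hz subrr normr0.
Qed.

End Grid.

Lemma far_scale g c d H : contracts_off g c d H -> (forall e, continuous (g e)) ->
  exists2 eps, 0 < eps & forall s t t' e e', 0 <= s <= 1 -> 0 <= t <= 1 ->
    0 <= t' <= 1 -> e \in c -> e' \in d -> 5 * eps <= `|H s (g e t) - g e' t'|.
Proof.
case=> cH _ _ HN cg.
pose P (q : (nat * nat) * (nat * nat)) eps := forall s t t', 0 <= s <= 1 ->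
  0 <= t <= 1 -> 0 <= t' <= 1 -> 5 * eps <= `|H s (g q.1 t) - g q.2 t'|.
have [|q /allpairsP[[e e'] /= [ec e'd ->]]|eps eps0 epsP] :=
  @common_scale _ [seq (e, e') | e <- c, e' <- d] P.
- move=> q eps eps' /andP[_ le_eps] Pq s t t' s01 t01 t'01.
  by apply: le_trans (Pq s t t' s01 t01 t'01); rewrite ler_pM2l ?ltr0n.
- have I01 : compact (`[0, 1] : set R) := @segment_compact R 0 1.
  have c3 := compact_setX (compact_setX I01 I01) I01.
  have [||[[s t] t'] [[/= s01 t01] t'01]|eta eta0 etaP] := @compact_dist_gt0 (R * R * R)%type _
    (fun p => H p.1.1 (g e p.1.2)) (fun p => g e' p.2) _ c3.
  + move=> p; apply: (@continuous_comp _ _ _ fst (fun p : R * R => H p.1 (g e p.2))).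
      exact: cvg_fst.
    exact: cH.
  + move=> p; apply: (@continuous_comp _ _ _ snd (g e')); first exact: cvg_snd.
    exact: cg.
  + by apply: HN.
  exists (eta / 5); first by rewrite divr_gt0.
  move=> s t t' s01 t01 t'01; rewrite mulrC divfK ?pnatr_eq0 //.
  by apply: (etaP ((s, t), t')); rewrite /= !in_itv.
exists eps => // s t t' e e' s01 t01 t'01 ec e'd.
by apply: (epsP (e, e')) => //; apply: allpairs_f.
Qed.

Lemma mesh_scale g (c : seq (nat * nat)) (F : R -> 'rV[R]_3 -> 'rV[R]_3) (eps : R) :
  (forall e, continuous (fun p : R * R => F p.1 (g e p.2))) -> 0 < eps ->
  exists2 delta : R, 0 < delta & forall M : nat, M%:R^-1 < delta -> fine_mesh g M eps c F.
Proof.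
move=> cF eps0.
pose P e (delta : R) := forall s s' t t', 0 <= s <= 1 -> 0 <= t <= 1 ->
  `|s - s'| < delta -> `|t - t'| < delta -> `|F s (g e t) - F s' (g e t')| < eps.
have [|e ec|delta delta0 deltaP] := @common_scale _ c P.
- move=> e d d' /andP[_ dd'] Pe s s' t t' s01 t01 ss' tt'.
  by apply: Pe => //; apply: lt_le_trans dd'.
- have I01 : compact (`[0, 1] : set R) := @segment_compact R 0 1.
  have [delta delta0 deltaP] := compact_uniform (compact_setX I01 I01) (cF e) eps0.
  exists delta => // s s' t t' s01 t01 ss' tt'.
  by apply: (deltaP (s, t) (s', t')); rewrite /= ?in_itv.
exists delta => // M Md e s s' t t' ec s01 _ t01 _ ss' tt'.
by apply: deltaP => //; apply: le_lt_trans Md.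
Qed.

(** Even codes are reserved for the labels on the moment curve, so that their
    order there is that of the natural numbers. *)
Definition label_code (t : label) : nat :=
  match t with inl n => n.*2 | inr y => (pickle y).*2.+1 end.

Definition label_param (t : label) : R := 1 - (label_code t).+1%:R^-1.

Lemma label_code_inj : injective label_code.
Proof.
move=> [m|y] [n|z] /=.
- by move=> /double_inj->.
- by move=> /(congr1 odd); rewrite /= !odd_double.
- by move=> /(congr1 odd); rewrite /= !odd_double.
- by move=> [] /double_inj /(pcan_inj pickleK)->.
Qed.

Lemma lt_label_param t u : (label_param t < label_param u) = (label_code t < label_code u)%N.
Proof. by rewrite /label_param ltrD2l ltrN2 ltf_pV2 ?posrE ?ltr0n // ltr_nat. Qed.

Lemma label_param_inj : injective label_param.
Proof.
move=> t u E; apply: label_code_inj; apply/eqP.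
by rewrite eqn_leq leqNgt -lt_label_param E ltxx leqNgt -lt_label_param E ltxx.
Qed.

Lemma label_param01 t : 0 <= label_param t <= 1.
Proof.
rewrite /label_param subr_ge0 lerBlDr lerDl invr_ge0 ler0n andbT.
by rewrite invf_le1 ?ltr0n // ler1n.
Qed.

Lemma pos_scaled_moment (k : R) a b c d : 0 < k -> uniq [:: a; b; c; d] ->
  pos (k *: moment (label_param (inl a))) (k *: moment (label_param (inl b)))
    (k *: moment (label_param (inl c))) (k *: moment (label_param (inl d))) =
  moment_sign a b c d.
Proof.
move=> k0 /=; rewrite !inE !negb_or -!andbA => /and5P[ab ac ad bc /and3P[bd cd _]].
rewrite /pos orient_scale pmulr_rgt0 ?exprn_gt0 // orient_moment.
have D m n : m != n :> nat -> (label_param (inl n) - label_param (inl m) != 0) *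
    ((0 < label_param (inl n) - label_param (inl m)) = ~~ (n < m)%N).
  move=> mn; rewrite subr_eq0 (inj_eq label_param_inj) (inj_eq (@inl_inj _ _)) eq_sym mn.
  split=> //; rewrite subr_gt0 lt_label_param /= ltn_double -leqNgt.
  by rewrite [RHS]leq_eqVlt (negPf mn).
rewrite !gt0_mul_sign ?mulf_neq0 ?D // /moment_sign.
by move: (b < a)%N (c < a)%N (d < a)%N (c < b)%N (d < b)%N (d < c)%N; do 6!case.
Qed.

(** If each of the nine pairs had a contraction, then a common scale for the
    nine grids and one perturbation into general position would make all the
    linking numbers of the polygons vanish, against link_parity. *)
Theorem contraction_obstruction (g : nat * nat -> R -> 'rV[R]_3) (A B : nat -> 'rV[R]_3) :
  (forall e, continuous (g e)) -> (forall e, g e 0 = A e.1) ->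
  (forall e, g e 1 = B e.2) ->
  exists2 k, k \in avoiding_pairs &
    forall H, ~ contracts_off g k.1 k.2 H /\ ~ contracts_off g k.2 k.1 H.
Proof.
move=> cg g0 g1; apply: contrapT => no.
pose key n := nth ([::], [::]) avoiding_pairs n.
pose fst_of (b : bool) n := if b then (key n).2 else (key n).1.
have /boolp.choice[bH bHP] n : exists bH : bool * (R -> 'rV[R]_3 -> 'rV[R]_3),
    (forall y, bH.2 0 y = y) /\ ((n < size avoiding_pairs)%N ->
      contracts_off g (fst_of bH.1 n) (fst_of (~~ bH.1) n) bH.2).
  have [ns|ns] := ltnP n (size avoiding_pairs); last first.
    by exists (true, fun _ y => y).
  have [[b H] bH] : exists bH : bool * (R -> 'rV[R]_3 -> 'rV[R]_3),
      contracts_off g (fst_of bH.1 n) (fst_of (~~ bH.1) n) bH.2.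
    apply: contrapT => noH; apply: no; exists (key n); first exact: mem_nth.
    move=> H; split=> HC; apply: noH; first by exists (false, H).
    by exists (true, H).
  by exists (b, H); split=> //= y; have [] := bH.
pose H n := (bH n).2; pose c n := fst_of (bH n).1 n; pose d n := fst_of (~~ (bH n).1) n.
have H0 n y : H n 0 y = y by exact: (bHP n).1.
have contr n : (n < size avoiding_pairs)%N -> contracts_off g (c n) (d n) (H n) by exact: (bHP n).2.
pose farP n (eps : R) := forall s t t' e e', 0 <= s <= 1 -> 0 <= t <= 1 ->
  0 <= t' <= 1 -> e \in c n -> e' \in d n -> 5 * eps <= `|H n s (g e t) - g e' t'|.
(* eps is small compared with the distances that the contractions keep, and
   delta makes the grid finer than eps. *)
have [|n|eps eps0 far] := @common_scale _ (iota 0 (size avoiding_pairs)) farP.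
- move=> n eps eps' /andP[_ le_eps] Pn s t t' e e' s01 t01 t'01 ec e'd.
  by apply: le_trans (Pn s t t' e e' s01 t01 t'01 ec e'd); rewrite ler_pM2l ?ltr0n.
- by rewrite mem_iota /= => /contr /far_scale /(_ cg).
pose meshP n (delta : R) := forall M : nat, M%:R^-1 < delta ->
  fine_mesh g M eps (c n) (H n) /\ fine_mesh g M eps (d n) (fun _ y => y).
have [|n|delta delta0 mesh] := @common_scale _ (iota 0 (size avoiding_pairs)) meshP.
- by move=> n a a' /andP[_ le_a] Pn M Ma; apply: Pn; apply: lt_le_trans le_a.
- rewrite mem_iota /= => /contr[cH _ _ _].
  have [d1 d10 P1] := mesh_scale (c n) cH eps0.
  have cId e : continuous (fun p : R * R => g e p.2).
    by move=> p; apply: (@continuous_comp _ _ _ snd (g e)); [exact: cvg_snd | exact: cg].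
  have [d2 d20 P2] := mesh_scale (d n) (F := fun _ y => y) cId eps0.
  exists (Num.min d1 d2); first by rewrite lt_min d10.
  by move=> M; rewrite lt_min => /andP[/P1 ? /P2 ?].
have [m] := ltr_add_invr delta0; rewrite add0r => mdelta.
pose M := m.+1.
pose base := label_position g A B H (fun n => moment (label_param (inl n))) M.
have [tau /andP[tau0 tau_eps] x_gen] := generic_perturbation base label_param_inj eps0.
pose x := perturb base label_param tau.
have x_close t : `|x t - base t| <= eps.
  rewrite /x /perturb addrAC subrr add0r normrZ gtr0_norm //.
  rewrite (le_trans _ (ltW tau_eps)) // ler_piMr ?(ltW tau0) //.
  exact/norm_moment/label_param01.
have x_moment a b c0 d0 : uniq [:: a; b; c0; d0] ->
    pos (x (inl a)) (x (inl b)) (x (inl c0)) (x (inl d0)) = moment_sign a b c0 d0.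
  move=> U; rewrite -(@pos_scaled_moment (1 + tau)) ?addr_gt0 //.
  by rewrite /x /perturb /base /= !scalerDl !scale1r.
have M0 : (0 < M)%N by [].
have := link_parity x_gen M0 x_moment; rewrite big_seq big1 // => k ks.
have [n ns <-] : exists2 n, (n < size avoiding_pairs)%N & key n = k.
  by exists (index k avoiding_pairs); rewrite ?index_mem // /key nth_index.
have nI : n \in iota 0 (size avoiding_pairs) by rewrite mem_iota.
have [c_fine d_fine] := mesh n nI M mdelta.
have /andP[ev1 ev2] := allP avoiding_pairs_even _ (mem_nth ([::], [::]) ns).
have dis := allP avoiding_pairs_disjoint_cycles _ (mem_nth ([::], [::]) ns).
have dis' := allP avoiding_pairs_disjoint_cycles_sym _ (mem_nth ([::], [::]) ns).
have := link_contracted g0 g1 H0 M0 x_gen eps0 x_close (contr n ns).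
have := far n nI; move: c_fine d_fine; rewrite /farP /c /d /fst_of.
case: (bH n).1 => /= c_fine d_fine cd_far link0; last exact: link0.
by rewrite link_cycle_paths //; exact: link0.
Qed.

End Approximation.

(** * A nonsplit link that misses a given edge *)

Section EdgePaths.
Variables (R : realType) (V : finType).

(** The universal property of the product topology. *)
Lemma continuous_bary (T : topologicalType) (w : T -> bary R V) :
  (forall v, continuous (fun t => w t v)) -> continuous w.
Proof.
move=> cw t; apply/cvg_sup => v U; rewrite nbhsE => -[_ [[C oC <-] Ct] sub].
have : nbhs t ((fun t => w t v) @^-1` C) by apply: cw; apply: open_nbhs_nbhs.
by apply: filterS => t' Ct'; apply: sub.
Qed.

(** Extends paths on the unit interval to continuous paths on the line. *)
Definition clamp (t : R) : R := Num.max 0 (Num.min 1 t).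

Lemma clamp01 t : 0 <= clamp t <= 1.
Proof. by rewrite /clamp le_max lexx /= ge_max ler01 ge_min lexx. Qed.

Lemma clamp_id t : 0 <= t <= 1 -> clamp t = t.
Proof. by case/andP=> t0 t1; rewrite /clamp (min_r t1) (max_r t0). Qed.

Lemma continuous_clamp : continuous clamp.
Proof.
move=> t; apply: continuous_max; first exact: cvg_cst.
by apply: continuous_min; [exact: cvg_cst | exact: cvg_id].
Qed.

Definition edge_point (a b : V) (t : R) : bary R V :=
  fun v => (1 - clamp t) * (v == a)%:R + clamp t * (v == b)%:R.

Lemma continuous_edge_point a b : continuous (edge_point a b).
Proof.
apply: continuous_bary => v t.
by apply: cvgD; apply: cvgMl; first apply: cvgB;
  [exact: cvg_cst | exact: continuous_clamp | exact: continuous_clamp].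
Qed.

Lemma edge_point0 a b : edge_point a b 0 = barycenter R a.
Proof.
by apply/funext => v; rewrite /edge_point clamp_id ?lexx ?ler01 // subr0 mul1r mul0r addr0.
Qed.

Lemma edge_point1 a b : edge_point a b 1 = barycenter R b.
Proof.
by apply/funext => v; rewrite /edge_point clamp_id ?lexx ?ler01 // subrr mul0r mul1r add0r.
Qed.

Lemma sum_delta (a : V) : \sum_v (v == a)%:R = 1 :> R.
Proof. by rewrite (bigD1 a) //= eqxx big1 ?addr0 // => v /negPf->. Qed.

Lemma edge_point_realization (K : {set {set V}}) a b t :
  [set a; b]%SET \in K -> realization K (edge_point a b t).
Proof.
move=> abK; have /andP[t0 t1] := clamp01 t; split.
- by move=> v; rewrite addr_ge0 // mulr_ge0 // subr_ge0.
- by rewrite big_split /= -!mulr_sumr !sum_delta !mulr1 subrK.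
- exists [set a; b]%SET => // v; rewrite !inE negb_or => /andP[/negPf va /negPf vb].
  by rewrite /edge_point va vb !mulr0 addr0.
Qed.

End EdgePaths.

Lemma cycle4_edges (T : finType) (x y z w : T) : uniq [:: x; y; z; w] ->
  [set [set u; next [:: x; y; z; w] u] | u in [:: x; y; z; w]]%SET =
  [set:: [:: [set x; y]; [set y; z]; [set z; w]; [set w; x]]]%SET.
Proof.
move=> U; have /and5P[xy xz xw yz /andP[yw zw]] :
    [&& x != y, x != z, x != w, y != z, y != w & z != w].
  by move: U; rewrite /= !inE !negb_or -!andbA andbT.
have sym (u v : T) : u != v -> (v == u) = false by rewrite eq_sym => /negPf.
have nx : next [:: x; y; z; w] x = y by rewrite /= eqxx.
have ny : next [:: x; y; z; w] y = z by rewrite /= (sym x y) // eqxx.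
have nz : next [:: x; y; z; w] z = w by rewrite /= (sym x z) // (sym y z) // eqxx.
have nw : next [:: x; y; z; w] w = x.
  by rewrite /= (sym x w) // (sym y w) // (sym z w) // eqxx.
apply/setP => s; rewrite inE; apply/imsetP/idP => [[u uc ->]|].
  have U4 : [|| u == x, u == y, u == z | u == w] by move: uc; rewrite !inE.
  by case/or4P: U4 => /eqP->; rewrite ?nx ?ny ?nz ?nw !inE eqxx ?orbT.
rewrite !inE => /or4P[] /eqP->; [exists x|exists y|exists z|exists w];
  by rewrite ?nx ?ny ?nz ?nw // !inE eqxx ?orbT.
Qed.

Section LowerBound.
Variables (R : realType) (G : sgraph) (a b : 'I_4 -> G).
Hypotheses (a_inj : injective a) (b_inj : injective b).
Hypothesis ab_adj : forall i j, adj (a i) (b j).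
Let A (i : nat) : G := a (inord i).
Let B (j : nat) : G := b (inord j).

Lemma ab_neq i j : (a i == b j) = false.
Proof. by apply/negP => /eqP E; have := ab_adj i j; rewrite E adj_irr. Qed.

Lemma ba_neq i j : (b j == a i) = false.
Proof. by rewrite eq_sym ab_neq. Qed.

Definition edge_set (c : seq (nat * nat)) : {set {set G}} :=
  [set:: [seq [set A e.1; B e.2]%SET | e <- c]]%SET.

Definition quadrilateral (c : seq (nat * nat)) :=
  let i := (nth (0, 0) c 0).1 in let i' := (nth (0, 0) c 2).1 in
  let j := (nth (0, 0) c 0).2 in let j' := (nth (0, 0) c 1).2 in
  [&& c == complete_cycle [:: i; i'] [:: j; j'], i != i', j != j' & all small_edge c].

Lemma avoiding_pairs_quadrilateral :
  all (fun k => quadrilateral k.1 && quadrilateral k.2) avoiding_pairs.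
Proof. by vm_compute. Qed.

Lemma A_eq i i' : (i < 4)%N -> (i' < 4)%N -> (A i == A i') = (i == i').
Proof.
by move=> i4 i'4; rewrite (inj_eq a_inj) -val_eqE /= !inordK.
Qed.

Lemma B_eq i i' : (i < 4)%N -> (i' < 4)%N -> (B i == B i') = (i == i').
Proof.
by move=> i4 i'4; rewrite (inj_eq b_inj) -val_eqE /= !inordK.
Qed.

Lemma edge_set_cycle c : quadrilateral c -> is_cycle (edge_set c).
Proof.
case/and4P=> /eqP; move: (nth _ c 0).1 (nth _ c 2).1 (nth _ c 0).2 (nth _ c 1).2.
move=> i i' j j' -> ii' jj' /and5P[/andP[/= i4 j4] /andP[_ j'4] /andP[i'4 _] _ _].
exists [:: A i; B j; A i'; B j'].
have U : uniq [:: A i; B j; A i'; B j'].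
  by rewrite /= !inE !ab_neq !ba_neq A_eq // B_eq // (negPf ii') (negPf jj').
split => //; first by rewrite /ucycle U /= !ab_adj !(adj_sym (B _)) !ab_adj.
rewrite cycle4_edges // /edge_set /complete_cycle /=.
rewrite (finset.setUC [set B j]%SET [set A i']%SET).
rewrite (finset.setUC [set B j']%SET [set A i]%SET).
by apply/setP => s; rewrite !inE; congr (_ || _); rewrite [in RHS]orbA [RHS]orbC.
Qed.

Lemma edge_eq i j i' j' : (i < 4)%N -> (j < 4)%N -> (i' < 4)%N -> (j' < 4)%N ->
  [set A i; B j]%SET = [set A i'; B j']%SET -> i = i' /\ j = j'.
Proof.
move=> i4 j4 i'4 j'4 /setP E; split; apply/eqP.
  by have := E (A i); rewrite !inE eqxx !ab_neq !orbF A_eq // => <-.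
by have := E (B j); rewrite !inE eqxx !ba_neq !orFb B_eq // => <-.
Qed.

Lemma cover_edge_set c v : v \in finset.cover (edge_set c) ->
  exists2 e, e \in c & v = A e.1 \/ v = B e.2.
Proof.
case/bigcupP=> s; rewrite inE => /mapP[e ec ->]; rewrite !inE => /orP[] /eqP->.
  by exists e => //; left.
by exists e => //; right.
Qed.

Lemma edge_set_disjoint c d : all small_edge c -> all small_edge d ->
  all (fun e => (e.1 \notin unzip1 c) && (e.2 \notin unzip2 c)) d ->
  [disjoint finset.cover (edge_set c) & finset.cover (edge_set d)]%B.
Proof.
move=> c4 d4 cd; rewrite -finset.setI_eq0; apply/eqP/setP => v; rewrite !inE.
apply/negP => /andP[/cover_edge_set[e ec ev] /cover_edge_set[e' e'd e'v]].
have /andP[e1 e2] := allP c4 e ec; have /andP[e'1 e'2] := allP d4 e' e'd.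
have /andP[n1 n2] := allP cd e' e'd.
case: ev e'v => -> [] /eqP; rewrite ?ab_neq ?ba_neq ?A_eq ?B_eq // => /eqP E.
  by move: n1; rewrite -E map_f.
by move: n2; rewrite -E map_f.
Qed.

Lemma edge_simplex i j : [set a i; b j]%SET \in simplices G.
Proof.
rewrite inE; apply/orP; right; apply/imsetP; exists (a i, b j) => //.
by rewrite inE /= ab_adj.
Qed.

Variable f : bary R G -> 'rV[R]_3.
Hypothesis f_cont : {within realization (simplices G), continuous f}.

Definition edge_curve (e : nat * nat) (t : R) := f (edge_point (A e.1) (B e.2) t).

Lemma continuous_edge_curve e : continuous (edge_curve e).
Proof.
move=> t; have inK (t' : R) : realization (simplices G) (edge_point (A e.1) (B e.2) t').
  exact/edge_point_realization/edge_simplex.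
have /subspace_continuousP/(_ _ (inK t)) := f_cont.
apply: cvg_trans => U /= fU.
have /= H := continuous_edge_point fU.
change (nbhs t (edge_curve e @^-1` U)).
change (nbhs t (edge_point (A e.1) (B e.2) @^-1`
  [set w | realization (simplices G) w -> U (f w)])) in H.
by apply: filterS H => t' /= /(_ (inK t')).
Qed.

Lemma edge_curve_in c e t : e \in c ->
  (f @` realization (edge_set c)) (edge_curve e t).
Proof.
move=> ec; exists (edge_point (A e.1) (B e.2) t) => //.
by apply: edge_point_realization; rewrite inE; apply/mapP; exists e.
Qed.

Lemma sqnormZ (s : R) (y : 'rV[R]_3) : sqnorm (s *: y) = s ^+ 2 * sqnorm y.
Proof. by rewrite /sqnorm mulr_sumr; apply: eq_bigr => i _; rewrite mxE exprMn. Qed.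

Lemma sqnorm_ge0 (y : 'rV[R]_3) : 0 <= sqnorm y.
Proof. by apply: sumr_ge0 => i _; apply: sqr_ge0. Qed.

(** The unit ball contracts radially to its centre; h brings this contraction
    back to the given embedding. *)
Lemma ball_contracts_off c d (h : 'rV[R]_3 -> 'rV[R]_3) : homeomorphism h ->
  h @` (f @` realization (edge_set c)) `<=` [set y | sqnorm y < 1] ->
  h @` (f @` realization (edge_set d)) `<=` [set y | 1 < sqnorm y] ->
  exists H, contracts_off edge_curve c d H.
Proof.
case=> ch [h' [ch' hK h'K]] hc hd.
exists (fun s y => h' ((1 - s) *: h y)); split.
- move=> e p; apply: continuous_comp; last exact: ch'.
  apply: cvgZ; first by apply: cvgB; [exact: cvg_cst | exact: cvg_fst].
  apply: (@continuous_comp _ _ _ snd (fun t => h (edge_curve e t))); first exact: cvg_snd.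
  by apply: continuous_comp; [exact: continuous_edge_curve | exact: ch].
- by move=> y; rewrite subr0 scale1r hK.
- by exists (h' 0) => y; rewrite subrr scale0r.
- move=> s t t' e e' /andP[s0 s1] _ _ ec e'd; apply/eqP => /(congr1 h); rewrite h'K => E.
  have := hc _ (ex_intro2 _ _ _ (edge_curve_in t ec) erefl).
  have := hd _ (ex_intro2 _ _ _ (edge_curve_in t' e'd) erefl).
  rewrite /= -E sqnormZ => H1 H2.
  suff : (1 - s) ^+ 2 * sqnorm (h (edge_curve e t)) <= 1 by rewrite leNgt H1.
  rewrite (le_trans _ (ltW H2)) // ler_piMl ?sqnorm_ge0 // exprn_ile1 //.
    by rewrite subr_ge0.
  by rewrite lerBlDr lerDl.
Qed.

(** One of the nine pairs has no contraction, hence is not split. *)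
Theorem link_avoiding_edge : exists L j,
  [/\ is_link f L, [set a ord0; b j]%SET \in finset.cover L &
      [set a ord0; b ord0]%SET \notin finset.cover L].
Proof.
have [k ks kN] := contraction_obstruction (B := fun j => f (barycenter R (B j)))
  (A := fun i => f (barycenter R (A i))) continuous_edge_curve
  (fun e => congr1 f (edge_point0 R (A e.1) (B e.2)))
  (fun e => congr1 f (edge_point1 R (A e.1) (B e.2))).
have /andP[q1 q2] := allP avoiding_pairs_quadrilateral k ks.
exists [set edge_set k.1; edge_set k.2]%SET.
have [j jk] : exists j, (0%N, j) \in k.1.
  have /allP/(_ k ks)/hasP[[i j] /= jk /eqP ij] :
    all (fun k => has (fun e => e.1 == 0%N) k.1) avoiding_pairs by vm_compute.
  by exists j; rewrite -ij.
have s1 : all small_edge k.1 by case/and4P: q1.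
have s2 : all small_edge k.2 by case/and4P: q2.
exists (inord j); split.
- exists (edge_set k.1), (edge_set k.2); split=> //; try exact: edge_set_cycle.
    by apply: edge_set_disjoint => //; apply: allP avoiding_pairs_disjoint_cycles k ks.
  case=> h hh [[hc hd]|[hd hc]].
    by have [H HC] := ball_contracts_off hh hc hd; have [] := kN H.
  by have [H HC] := ball_contracts_off hh hd hc; have [] := kN H.
- apply/bigcupP; exists (edge_set k.1); first by rewrite !inE eqxx.
  rewrite inE; apply/mapP; exists (0%N, j) => //=; rewrite /A /B.
  by rewrite (_ : inord 0 = ord0) //; apply/val_inj; rewrite /= inordK.
- apply/negP => /bigcupP[C]; rewrite !inE => CL abC.
  have {C CL abC} : [set A 0; B 0]%SET \in [seq [set A e.1; B e.2]%SET | e <- k.1 ++ k.2].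
    have o : inord 0 = ord0 :> 'I_4 by apply/val_inj; rewrite /= inordK.
    rewrite map_cat mem_cat /A /B o.
    by case/orP: CL abC => /eqP->; rewrite inE => ->; rewrite ?orbT.
  case/mapP => e ek; have e4 : small_edge e.
    by move: ek; rewrite mem_cat => /orP[/(allP s1)|/(allP s2)].
  case/andP: (e4) => e14 e24 /(edge_eq _ _ e14 e24)[] // e1 e2.
  have : (0%N, 0%N) \notin k.1 ++ k.2.
    have /allP/(_ k ks) // : all (fun k => (0%N, 0%N) \notin k.1 ++ k.2) avoiding_pairs.
    by vm_compute.
  by move: ek; rewrite (surjective_pairing e) -e1 -e2 => ->.
Qed.

End LowerBound.

(** * Splitting by a shear *)

Section Shear.
Variable R : realType.
Implicit Types (p q c d : 'rV[R]_3) (C D : set 'rV[R]_3).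

Definition vec3 (u v w : R) : 'rV[R]_3 := \row_k [:: u; v; w]`_k.

Lemma cx_vec3 u v w : cx (vec3 u v w) = u.
Proof. by rewrite /cx mxE inordK. Qed.
Lemma cy_vec3 u v w : cy (vec3 u v w) = v.
Proof. by rewrite /cy mxE inordK. Qed.
Lemma cz_vec3 u v w : cz (vec3 u v w) = w.
Proof. by rewrite /cz mxE inordK. Qed.
Definition vec3E := (cx_vec3, cy_vec3, cz_vec3).

Lemma cxD p q : cx (p + q) = cx p + cx q. Proof. by rewrite /cx mxE. Qed.
Lemma cyD p q : cy (p + q) = cy p + cy q. Proof. by rewrite /cy mxE. Qed.
Lemma czD p q : cz (p + q) = cz p + cz q. Proof. by rewrite /cz mxE. Qed.
Lemma cxZ k p : cx (k *: p) = k * cx p. Proof. by rewrite /cx mxE. Qed.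
Lemma cyZ k p : cy (k *: p) = k * cy p. Proof. by rewrite /cy mxE. Qed.
Lemma czZ k p : cz (k *: p) = k * cz p. Proof. by rewrite /cz mxE. Qed.
Definition coordE := (cxD, cyD, czD, cxZ, cyZ, czZ, cx_vec3, cy_vec3, cz_vec3).

Lemma sqnorm_coord p : sqnorm p = cx p ^+ 2 + cy p ^+ 2 + cz p ^+ 2.
Proof.
rewrite /sqnorm !big_ord_recl big_ord0 addr0 addrA /cx /cy /cz.
by congr (_ ^+ 2 + _ ^+ 2 + _ ^+ 2); congr (p _ _); apply/val_inj; rewrite /= inordK.
Qed.

Lemma continuous_cz : continuous (@cz R).
Proof. exact: coord_continuous. Qed.

Definition up : 'rV[R]_3 := vec3 0 0 1.

Definition shadow p : 'rV[R]_3 := p - cz p *: up.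

Lemma continuous_shadow : continuous shadow.
Proof.
move=> p; apply: (@cvgB R _ _ (nbhs p) _ id (fun q => cz q *: up)).
  exact: cvg_id.
by apply: (@cvgZ R _ _ (nbhs p)); [exact: continuous_cz | exact: cvg_cst].
Qed.

Lemma shadow_up p s : shadow (p + s *: up) = shadow p.
Proof.
by apply: vector3P; rewrite /shadow -!scaleNr !coordE; ring.
Qed.

Lemma shadowP p q : (shadow p == shadow q) = (cx p == cx q) && (cy p == cy q).
Proof.
apply/eqP/andP => [E|[/eqP ex /eqP ey]].
  have := congr1 (@cx R) E; have := congr1 (@cy R) E.
  by rewrite /shadow -!scaleNr !coordE !mulr0 !addr0 => -> ->.
by apply: vector3P; rewrite /shadow -!scaleNr !coordE ?mulr0 ?addr0 // !mulr1 !subrr.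
Qed.

(** Where n is small u is negative, and elsewhere u is bounded and n is
    bounded from below. *)
Lemma compact_slope (X : topologicalType) (A : set X) (u n : X -> R) :
  compact A -> continuous u -> continuous n -> (forall x, 0 <= n x) ->
  (forall x, A x -> n x = 0 -> u x < 0) ->
  exists2 k, 0 < k & forall x, A x -> u x < k * n x.
Proof.
move=> /compact_near_coveringP cA cu cn n0 nu.
have cov : \forall k \near +oo, A `<=` [set x | u x < k * n x].
  apply: cA => x Ax; have [E|N0] := eqVneq (n x) 0.
    exists ([set y | u y < 0], [set k | 0 < k]).
      split; last by exists 0; split; rewrite ?num_real.
      exact: (cvgr_lt _ (cu x) _ (nu x Ax E)).
    by case=> y k [/= y0 k0]; rewrite (lt_le_trans y0) // mulr_ge0 // ltW.
  have nx : 0 < n x by rewrite lt_neqAle eq_sym N0 n0.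
  pose b := `|u x| + 1; have b0 : 0 < b by rewrite ltr_wpDl.
  exists ([set y | u y < b /\ n x / 2 < n y], [set k | b / (n x / 2) < k]).
    split; last by exists (b / (n x / 2)); split; rewrite ?num_real.
    near=> y; split; near: y.
      by apply: (cvgr_lt _ (cu x)); rewrite /b (le_lt_trans (ler_norm _)) // ltrDl.
    by apply: (cvgr_gt _ (cn x)); rewrite ltr_pdivrMr // ltr_pMr // ltr1n.
  case=> y k [/= [y1 y2] kb]; rewrite (lt_le_trans y1) //.
  have k0 : 0 < k by apply: lt_trans kb; rewrite !divr_gt0.
  by rewrite (le_trans (ltW _) (ler_wpM2l (ltW k0) (ltW y2))) // -ltr_pdivrMr ?divr_gt0.
have [k [k0 kP]] : exists k : R, 0 < k /\ A `<=` [set x | u x < k * n x].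
  near (+oo : set_system R) => k; exists k; split; near: k => //.
  by exists 0; split; rewrite ?num_real.
by exists k.
Unshelve. all: by end_near. Qed.

Let V := 'rV[R]_3.

Lemma continuous_height_drop : continuous (fun x : V * V => cz x.2 - cz x.1).
Proof.
move=> x; apply: (@continuousB _ _ _ (fun x : V * V => cz x.2) (fun x : V * V => cz x.1)).
  by apply: (@continuous_comp _ _ _ snd (@cz R)); [exact: cvg_snd | exact: continuous_cz].
by apply: (@continuous_comp _ _ _ fst (@cz R)); [exact: cvg_fst | exact: continuous_cz].
Qed.

Lemma continuous_shadow_dist : continuous (fun x : V * V => `|shadow x.1 - shadow x.2|).
Proof.
move=> x; apply: (@continuous_comp _ _ _ (fun x : V * V => shadow x.1 - shadow x.2) Num.norm);
  last exact: norm_continuous.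
apply: (@continuousB _ _ _ (fun x : V * V => shadow x.1) (fun x : V * V => shadow x.2)).
  by apply: (@continuous_comp _ _ _ fst shadow); [exact: cvg_fst | exact: continuous_shadow].
by apply: (@continuous_comp _ _ _ snd shadow); [exact: cvg_snd | exact: continuous_shadow].
Qed.

(** A cone of slope K that opens upwards from a point of C misses D, by a
    margin that compactness makes uniform. *)
Lemma separation_gap C D : compact C -> compact D -> C !=set0 -> D !=set0 ->
  (forall c d, C c -> D d -> shadow c = shadow d -> cz d < cz c) ->
  exists K m, [/\ 0 < K, 0 < m & forall c d, C c -> D d ->
    cz d + m <= cz c + K * `|shadow c - shadow d|].
Proof.
move=> cC cD [c0 Cc0] [d0 Dd0] CD; have cCD := compact_setX cC cD.
have [|[c d] [/= Cc Dd] /eqP|K K0 KP] := compact_slope cCD continuous_height_drop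
  continuous_shadow_dist.
- by move=> x; apply: normr_ge0.
- by rewrite normr_eq0 subr_eq0 subr_lt0 => /eqP; apply: CD.
pose gap (x : V * V) := K * `|shadow x.1 - shadow x.2| - (cz x.2 - cz x.1).
have cgap : continuous gap.
  move=> x; apply: (@continuousB _ _ _ (fun x : V * V => K * `|shadow x.1 - shadow x.2|)
    (fun x : V * V => cz x.2 - cz x.1)); last exact: continuous_height_drop.
  by apply: (@continuousM _ _ (cst K)); [exact: cvg_cst | exact: continuous_shadow_dist].
have CD0 : C `*` D !=set0 by exists (c0, d0).
have [[c1 d1]] := compact_EVT_min CD0 cCD (continuous_subspaceT cgap).
rewrite inE => -[/= Cc1 Dd1] gap_min.
exists K, (gap (c1, d1)); split=> //.
  by rewrite subr_gt0; apply: (KP (c1, d1)).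
move=> c d Cc Dd; have := gap_min (c, d); rewrite inE => /(_ (conj Cc Dd)).
by rewrite {2}/gap /= => H; lra.
Qed.

Lemma continuous_dominated (X : topologicalType) (W : normedModType R)
    (g : X -> R) (s : X -> W) (K : R) : 0 < K -> continuous s ->
  (forall x y, `|g x - g y| <= K * `|s x - s y|) -> continuous g.
Proof.
move=> K0 cs gs x; apply/cvgrPdist_lt => e e0.
have eK : 0 < e / K by rewrite divr_gt0.
have /cvgrPdist_lt/(_ _ eK) := cs x.
apply: filterS => y; rewrite ltr_pdivlMr // mulrC => H.
exact: le_lt_trans (gs x y) H.
Qed.

Lemma continuous_sqnorm : continuous (@sqnorm R : V -> R).
Proof.
have sq (k : V -> R) : continuous k -> continuous (fun p => k p ^+ 2).
  by move=> ck p; apply: (@continuous_comp _ _ _ k (fun t : R => t ^+ 2));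
    [exact: ck | exact: exprn_continuous].
have -> : @sqnorm R = fun p : V => cx p ^+ 2 + cy p ^+ 2 + cz p ^+ 2.
  by apply/funext => p; rewrite sqnorm_coord.
move=> p; apply: (@continuousD _ _ _ (fun p : V => cx p ^+ 2 + cy p ^+ 2) (fun p => cz p ^+ 2)).
  apply: (@continuousD _ _ _ (fun p : V => cx p ^+ 2) (fun p => cy p ^+ 2));
    by apply: sq; exact: coord_continuous.
by apply: sq; exact: coord_continuous.
Qed.

Lemma sqnorm_shift p (r : R) :
  sqnorm (p + r *: up) = sqnorm p + 2 * r * cz p + r ^+ 2.
Proof. by rewrite !sqnorm_coord !coordE; ring. Qed.

(** The lower envelope g of the cones of separation_gap over all the points of
    C is a Lipschitz function of the shadow, and its graph, lowered by m / 2,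
    lies between C and D.  The shear that flattens this graph moves C above
    and D below a horizontal plane, and the ball of a large radius rho that
    touches the plane from below contains D. *)
Lemma above_split C D : compact C -> compact D -> C !=set0 -> D !=set0 ->
  (forall c d, C c -> D d -> shadow c = shadow d -> cz d < cz c) ->
  split_link C D.
Proof.
move=> cC cD C0 D0 CD; have [K [m [K0 m0 gap]]] := separation_gap cC cD C0 D0 CD.
pose F p c := cz c + K * `|shadow p - shadow c|.
have cF p : continuous (F p).
  move=> c; apply: (@continuousD _ _ _ (@cz R) (fun c => K * `|shadow p - shadow c|)).
    exact: continuous_cz.
  apply: (@continuousM _ _ (cst K) (fun c => `|shadow p - shadow c|)); first exact: cst_continuous.
  apply: (@continuous_comp _ _ _ (fun c : V => shadow p - shadow c) Num.norm);
    last exact: norm_continuous.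
  apply: (@continuousB _ _ _ (cst (shadow p)) shadow); first exact: cst_continuous.
  exact: continuous_shadow.
have /boolp.choice[low lowP] p : exists c, C c /\ forall c', C c' -> F p c <= F p c'.
  have [c cC' cmin] := compact_EVT_min C0 cC (continuous_subspaceT (cF p)).
  exists c; split; first by rewrite -in_setE.
  by move=> c' Cc'; apply: cmin; rewrite inE.
pose g p := F p (low p) - m / 2.
have g_le p c : C c -> g p <= F p c - m / 2 by move=> Cc; rewrite lerD2r; apply: (lowP p).2.
have g_lip1 p q : g p - g q <= K * `|shadow p - shadow q|.
  rewrite lerBlDr (le_trans (g_le p _ (lowP q).1)) // [in leRHS]/g addrA lerD2r.
  by rewrite /F addrCA lerD2l -mulrDr ler_pM2l // ler_distD.
have g_lip p q : `|g p - g q| <= K * `|shadow p - shadow q|.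
  by rewrite ler_norml g_lip1 andbT lerNl opprB distrC g_lip1.
have cg : continuous g := continuous_dominated K0 continuous_shadow g_lip.
have g_up p s : g (p + s *: up) = g p.
  apply/eqP; rewrite -subr_eq0 -normr_le0 (le_trans (g_lip _ _)) //.
  by rewrite shadow_up subrr normr0 mulr0.
pose h0 p := p + (- g p) *: up.
have h0K p : h0 p + g (h0 p) *: up = p.
  by rewrite /h0 g_up -addrA -scalerDl addNr scale0r addr0.
have h0K' p : h0 (p + g p *: up) = p.
  by rewrite /h0 g_up -addrA -scalerDl subrr scale0r addr0.
have ch0 : continuous h0.
  move=> p; apply: (@continuousD _ _ _ id (fun p => (- g p) *: up)); first exact: cvg_id.
  apply: (@cvgZ R _ _ (nbhs p) _ (fun q => - g q)); last exact: cvg_cst.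
  exact: (@continuousN _ _ _ g p (cg p)).
have czh0 p : cz (h0 p) = cz p - g p by rewrite /h0 !coordE mulr1.
have cS : continuous (fun p => sqnorm (h0 p)).
  by move=> p; apply: (@continuous_comp _ _ _ h0 (@sqnorm R));
    [exact: ch0 | exact: continuous_sqnorm].
have [d1 _ d1max] := compact_EVT_max D0 cD (continuous_subspaceT cS).
(* With this radius the drop of D below the plane outweighs its size. *)
pose rho := (`|sqnorm (h0 d1)| + 1) / m.
have rho0 : 0 < rho by rewrite divr_gt0 // ltr_wpDl.
pose h p := rho^-1 *: (h0 p + rho *: up).
have sqh p : sqnorm (h p) = rho^-1 ^+ 2 * (sqnorm (h0 p) + 2 * rho * cz (h0 p)) + 1.
  rewrite /h sqnorm_coord !(cxZ, cyZ, czZ) !exprMn -!mulrDr -sqnorm_coord.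
  by rewrite sqnorm_shift mulrDr -[X in _ + X]exprMn mulVf ?gt_eqF // expr1n.
exists h.
  split.
    move=> p; apply: (@cvgZ R _ _ (nbhs p) _ (cst rho^-1) (fun p => h0 p + rho *: up)).
      exact: cst_continuous.
    apply: (@continuousD _ _ _ h0 (cst (rho *: up))); first exact: ch0.
    exact: cst_continuous.
  exists (fun y => (rho *: y - rho *: up) + g (rho *: y - rho *: up) *: up); split.
  - have cl : continuous (fun y : V => rho *: y - rho *: up).
      move=> p; apply: (@continuousB _ _ _ (fun y : V => rho *: y) (cst (rho *: up))).
        by apply: (@cvgZ R _ _ (nbhs p) _ (cst rho) id); [exact: cst_continuous | exact: cvg_id].
      exact: cst_continuous.
    move=> p; apply: (@continuousD _ _ _ (fun y : V => rho *: y - rho *: up)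
      (fun y => g (rho *: y - rho *: up) *: up)); first exact: cl.
    apply: (@cvgZ R _ _ (nbhs p) _ (fun y => g (rho *: y - rho *: up))); last exact: cvg_cst.
    by apply: (@continuous_comp _ _ _ (fun y : V => rho *: y - rho *: up) g);
      [exact: cl | exact: cg].
  - move=> p; rewrite /h scalerA divff ?gt_eqF // scale1r addrK.
    by rewrite h0K.
  - move=> y; rewrite /h h0K' subrK.
    by rewrite scalerA mulVf ?gt_eqF // scale1r.
right; split=> _ [p Pp <-] /=; rewrite sqh.
- have /(_ (low p) p (lowP p).1 Pp) := gap; rewrite distrC => gp.
  have : sqnorm (h0 p) <= sqnorm (h0 d1) by apply: d1max; rewrite inE.
  have : cz (h0 p) <= - (m / 2) by rewrite czh0 /g /F; lra.
  move=> H1 H2; rewrite -subr_lt0 addrK pmulr_rlt0 ?exprn_gt0 ?invr_gt0 //.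
  have H3 : 2 * (rho * cz (h0 p)) <= - (rho * m).
    by rewrite -mulrN mulrCA ler_pM2l // mulrC -ler_pdivlMr // mulNr.
  rewrite -mulrA (le_lt_trans (lerD H2 H3)) // subr_lt0 /rho divfK ?gt_eqF //.
  by rewrite (le_lt_trans (ler_norm _)) // ltrDl.
- have := g_le p p Pp; rewrite /F subrr normr0 mulr0 addr0 => gp.
  have : m / 2 <= cz (h0 p) by rewrite czh0; lra.
  move=> H1; rewrite -subr_gt0 addrK mulr_gt0 ?exprn_gt0 ?invr_gt0 //.
  have cz0 : 0 < cz (h0 p) by apply: lt_le_trans H1; rewrite divr_gt0.
  apply: ltr_wpDl; first by apply: sumr_ge0 => i _; apply: sqr_ge0.
  by apply: mulr_gt0 cz0; apply: mulr_gt0 rho0.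
Qed.

End Shear.

(** * A straight embedding on two skew lines *)

Lemma continuous_combination (R : realType) (X : topologicalType)
    (W : normedModType R) (I : Type) (r : seq I) (k : I -> X -> R) (v : I -> W) :
  (forall i, continuous (k i)) -> continuous (fun x => \sum_(i <- r) k i x *: v i).
Proof.
move=> ck; elim: r => [|i r IH] x.
  by under eq_fun do rewrite big_nil; exact: cvg_cst.
under eq_fun do rewrite big_cons.
apply: cvgD; last exact: IH.
by apply: cvgZ; [exact: ck | exact: cvg_cst].
Qed.

Section Straight.
Variables (R : realType) (V : finType) (pos : V -> 'rV[R]_3).

Definition straight (w : bary R V) : 'rV[R]_3 := \sum_v w v *: pos v.

Lemma straight_edge_point x y t : 0 <= t <= 1 ->
  straight (edge_point x y t) = (1 - t) *: pos x + t *: pos y.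
Proof.
move=> t01; rewrite /straight /edge_point clamp_id //.
under eq_bigr => v _ do rewrite scalerDl -!scalerA.
have S z : \sum_v (v == z)%:R *: pos v = pos z.
  by rewrite (bigD1 z) //= eqxx scale1r big1 ?addr0 // => v /negPf->; rewrite scale0r.
by rewrite big_split /= -!scaler_sumr !S.
Qed.

Lemma straight_barycenter x : straight (barycenter R x) = pos x.
Proof.
by rewrite -(edge_point0 R x x) straight_edge_point ?lexx ?ler01 // subr0 scale1r scale0r addr0.
Qed.

Lemma continuous_straight : continuous straight.
Proof.
exact: (@continuous_combination R (bary R V) _ _ (index_enum V) (fun v w => w v) pos
  (@proj_continuous V (fun=> R))).
Qed.

(** The second barycentric coordinate is the parameter. *)
Lemma edge_pointP (w : bary R V) (x y : V) : x != y -> (forall v, 0 <= w v) ->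
  \sum_v w v = 1 -> (forall v, v \notin [set x; y]%SET -> w v = 0) ->
  exists2 t, 0 <= t <= 1 & w = edge_point x y t.
Proof.
move=> xy w0 w1 wN.
have sum_xy : w x + w y = 1.
  rewrite -w1 (bigD1 x) //= (bigD1 y) 1?eq_sym //= big1 ?addr0 // => v /andP[vx vy].
  by apply: wN; rewrite !inE negb_or vx.
have t01 : 0 <= w y <= 1 by rewrite w0 -sum_xy lerDr w0.
exists (w y) => //; apply/funext => v; rewrite /edge_point clamp_id //.
have [->|vx] := eqVneq v x; first by rewrite (negPf xy) mulr0 addr0 mulr1 -sum_xy addrK.
have [->|vy] := eqVneq v y; first by rewrite mulr0 add0r mulr1.
by rewrite !mulr0 addr0 wN // !inE negb_or vx.
Qed.

Lemma straight_edge x y : x != y ->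
  straight @` realization [set [set x; y]%SET]%SET = segment (pos x) (pos y).
Proof.
move=> xy; apply/seteqP; split=> [_ [w [w0 w1 [s sK wN]] <-]|_ [t t01 <-]].
  move: sK wN; rewrite inE => /eqP-> wN; have [t t01 ->] := edge_pointP xy w0 w1 wN.
  by exists t => //; rewrite straight_edge_point.
exists (edge_point x y t); last by rewrite straight_edge_point.
by apply: edge_point_realization; rewrite inE.
Qed.

End Straight.

Lemma homeomorphism_id (R : realType) : homeomorphism (@id 'rV[R]_3).
Proof. by split=> [p|]; [exact: cvg_id | exists id; split=> // p; exact: cvg_id]. Qed.

(** All edges are segments already. *)
Lemma straight_tame (R : realType) (G : sgraph) (pos : G -> 'rV[R]_3) :
  tame (straight pos).
Proof.
exists id; first exact: homeomorphism_id.
move=> x y xy; exists [::]; have xNy : x != y.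
  by apply: contraTneq xy => ->; rewrite adj_irr.
have -> : id \o straight pos = straight pos by [].
rewrite straight_edge // !straight_barycenter /=.
apply/seteqP; split=> [z|z [//|->]]; first by left.
by exists 1; rewrite /= ?lexx ?ler01 // subrr scale0r scale1r add0r.
Qed.

Notation K44 := (complete_multipartite [:: 4%N; 4%N]).

Definition va (i : 'I_4) : K44 := existT _ (Ordinal (isT : (0 < 2)%N)) i.
Definition vb (j : 'I_4) : K44 := existT _ (Ordinal (isT : (1 < 2)%N)) j.

Lemma va_inj : injective va.
Proof. by move=> i i' /eqP; rewrite -tag_eqE /tag_eq /= tagged_asE => /eqP. Qed.
Lemma vb_inj : injective vb.
Proof. by move=> i i' /eqP; rewrite -tag_eqE /tag_eq /= tagged_asE => /eqP. Qed.
Lemma va_vb_adj i j : adj (va i) (vb j).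
Proof. by []. Qed.

Lemma K44_cases (v : K44) : (exists i, v = va i) \/ (exists j, v = vb j).
Proof.
case: v => -[[|[|//]] lt] i; move: i; rewrite (bool_irrelevance lt isT) => i.
  by left; exists i.
by right; exists i.
Qed.

Section Explicit.
Variable R : realType.

(** Two vertices on each side of the origin of each line, so that the view
    from above has few crossings. *)
Definition alpha (n : nat) : R := nth 0 [:: -2; -1; 1; 2] n.

Definition position (v : K44) : 'rV[R]_3 :=
  if tag v == 0%N :> nat then vec3 (alpha (tagged v)) 0 0
  else vec3 0 (alpha (tagged v)) 1.

Lemma alpha_inj : injective (fun i : 'I_4 => alpha i).
Proof.
move=> [[|[|[|[|//]]]] lt] [[|[|[|[|//]]]] lt'] /=; rewrite /alpha /= => E;
  apply/val_inj => //=; exfalso; lra.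
Qed.

Definition picture := straight position.

Lemma pictureE i j t : 0 <= t <= 1 ->
  picture (edge_point (va i) (vb j) t) = vec3 ((1 - t) * alpha i) (t * alpha j) t.
Proof.
move=> t01; rewrite /picture straight_edge_point //.
by apply: vector3P; rewrite !coordE !(mulr0, addr0, add0r, mulr1).
Qed.

Lemma va_neq_vb i j : va i != vb j. Proof. by []. Qed.

Lemma realization_K44 (w : bary R K44) : realization (simplices K44) w ->
  exists i j t, 0 <= t <= 1 /\ w = edge_point (va i) (vb j) t.
Proof.
case=> w0 w1 [s sK wN].
suff [i [j sij]] : exists i j, s \subset [set va i; vb j]%SET.
  have [|t t01 ->] := edge_pointP (va_neq_vb i j) w0 w1; last by exists i, j, t.
  by move=> v vN; apply: wN; apply: contra vN => vs; apply: (fintype.subsetP sij).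
move: sK; rewrite inE => /orP[/imsetP[x _ ->]|/imsetP[[x y] /= xy ->]].
  have [[i ->]|[j ->]] := K44_cases x.
    by exists i, ord0; rewrite finset.sub1set !inE eqxx.
  by exists ord0, j; rewrite finset.sub1set !inE eqxx orbT.
move: xy; rewrite inE /=.
have [[i ->]|[j ->]] := K44_cases x; have [[i' ->]|[j' ->]] := K44_cases y => // _.
  by exists i, j'.
by exists i', j; rewrite finset.setUC.
Qed.

(** A tetrahedron is the join of two opposite edges: the height of a point
    gives its parameter t, and then the horizontal coordinates give the two
    ends of the segment through it. *)
Lemma picture_embedding : embedding picture.
Proof.
split; first exact/continuous_subspaceT/continuous_straight.
move=> w w'; rewrite !in_setE => /realization_K44[i [j [t [t01 ->]]]].
case/realization_K44 => i' [j' [t' [t'01 ->]]]; rewrite !pictureE // => E.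
have := congr1 (@cz R) E; have := congr1 (@cx R) E; have := congr1 (@cy R) E.
rewrite !vec3E => Ey Ex Et; rewrite -{}Et {t' t'01 E} in Ey Ex *.
have [t0|t0] := eqVneq t 0.
  move: Ex; rewrite t0 subr0 !mul1r => /alpha_inj->.
  by rewrite !edge_point0.
have [t1|t1] := eqVneq t 1.
  move: Ey; rewrite t1 !mul1r => /alpha_inj->.
  by rewrite !edge_point1.
have -> : j = j' by apply: alpha_inj; apply: (mulfI t0).
by have -> : i = i' by apply: alpha_inj; apply: (@mulfI _ (1 - t)) => //; rewrite subr_eq0 eq_sym.
Qed.

End Explicit.

(** * Disjoint cycles and the crossings of the embedding *)

(** Going once around, the side changes at every step and is restored at the
    end. *)
Lemma alternating_cycle_even (T : eqType) (s : T -> bool) (e : rel T) (c : seq T) :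
  (forall x y, e x y -> s x != s y) -> cycle e c -> ~~ odd (size c).
Proof.
move=> es; case: c => //= x p.
have P y q : path e y q -> s (last y q) = s y (+) odd (size q).
  elim: q y => [|z q IH] y /=; first by rewrite addbF.
  by case/andP=> /es yz /IH->; move: yz; case: (s y); case: (s z); case: odd.
move/P; rewrite last_rcons size_rcons /=.
by case: (s x); case: odd.
Qed.

Definition quad (I J : {set 'I_4}) : {set {set K44}} :=
  [set [set va p.1; vb p.2] | p in finset.setX I J]%SET.

Lemma quadE (i i' j j' : 'I_4) : quad [set i; i'] [set j; j'] =
  [set:: [:: [set va i; vb j]; [set va i; vb j']; [set va i'; vb j]; [set va i'; vb j']]]%SET.
Proof.
apply/setP => s; rewrite !inE; apply/imsetP/idP => [[[p q]]|].
  by rewrite !inE => /andP[/orP[] /= /eqP-> /orP[] /eqP->] ->; rewrite eqxx ?orbT.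
case/or4P=> /eqP->; [exists (i, j)|exists (i, j')|exists (i', j)|exists (i', j')];
  by rewrite // !inE !eqxx ?orbT.
Qed.

Lemma cycle4_quad (c : seq K44) : ucycle (@adj K44) c -> size c = 4%N ->
  exists i i' j j', perm_eq c [:: va i; vb j; va i'; vb j'] /\
    [set [set x; next c x] | x in c]%SET = quad [set i; i'] [set j; j'].
Proof.
case: c => [|x [|y [|z [|w [|//]]]]] // /andP[cyc U] _.
rewrite cycle4_edges //; move: cyc => /= /and5P[xy yz zw wx _].
have [[i ex]|[j ex]] := K44_cases x; have [[i' ey]|[j' ey]] := K44_cases y;
  rewrite ex ey // in xy;
have [[k ez]|[l ez]] := K44_cases z; rewrite ey ez // in yz;
have [[k' ew]|[l' ew]] := K44_cases w; rewrite ez ew // in zw; rewrite {}ex {}ey {}ez {}ew.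
- exists i, k, j', l'; split=> //; rewrite quadE.
  rewrite (finset.setUC [set vb j']%SET) (finset.setUC [set vb l']%SET).
  by apply/setP => s; rewrite !inE; congr (_ || _); rewrite [in LHS]orbA [LHS]orbC.
- exists i', k', j, l; split.
    by rewrite (perm_catCA [:: vb j] [:: va i']) perm_cons perm_cons
      (perm_catC [:: vb l] [:: va k']).
  rewrite quadE (finset.setUC [set vb j]%SET) (finset.setUC [set vb l]%SET).
  by apply/setP => s; rewrite !inE [X in _ || (_ || X)]orbC.
Qed.

Lemma cover_cycle (c : seq K44) x : x \in c ->
  x \in finset.cover [set [set x; next c x] | x in c]%SET.
Proof.
move=> xc; apply/bigcupP; exists [set x; next c x]%SET; last by rewrite !inE eqxx.
by apply/imsetP; exists x.
Qed.

(** Cycles of a bipartite graph have even length, so two disjoint ones use at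
    least 4 + 4 vertices, that is all of them. *)
Lemma disjoint_cycles_K44 (C D : {set {set K44}}) : is_cycle C -> is_cycle D ->
  [disjoint finset.cover C & finset.cover D]%B ->
  exists i i' j j' k k' l l', [/\ uniq [:: i; i'; k; k'], uniq [:: j; j'; l; l'],
    C = quad [set i; i'] [set j; j'] & D = quad [set k; k'] [set l; l']].
Proof.
case=> c [cc c2 ->] [d [cd d2 ->]] dis.
have Ucd : uniq (c ++ d).
  rewrite cat_uniq; case/andP: (cc) (cd) => _ -> /andP[_ ->]; rewrite andbT /=.
  apply/hasPn => x xd; apply/negP => xc.
  by have /negP := disjointFr dis (cover_cycle xc); apply; apply: cover_cycle.
have even_size b : ucycle (@adj K44) b -> ~~ odd (size b).
  case/andP=> cb _; apply: (alternating_cycle_even (s := fun v : K44 => tag v == ord0)) cb.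
  by move=> x y; have [[i ->]|[i ->]] := K44_cases x; have [[j ->]|[j ->]] := K44_cases y.
have := even_size c cc; have := even_size d cd.
have le8 : (size (c ++ d) <= 8)%N.
  pose L := map va (enum 'I_4) ++ map vb (enum 'I_4).
  have -> : 8%N = size L by rewrite size_cat !size_map -enumT size_enum_ord.
  apply: uniq_leq_size => // v _; rewrite mem_cat.
  by have [[i ->]|[j ->]] := K44_cases v; rewrite map_f ?orbT // mem_enum.
move=> od oc; have [sc sd] : size c = 4%N /\ size d = 4%N.
  move: c2 d2 od oc le8; rewrite size_cat.
  move: (size c) (size d) => m n.
  by move: m n => [|[|[|[|[|[|m]]]]]] [|[|[|[|[|[|n]]]]]] //=; rewrite ?addnS ?addSn.
have [i [i' [j [j' [pc ->]]]]] := cycle4_quad cc sc.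
have [k [k' [l [l' [pd ->]]]]] := cycle4_quad cd sd.
have U : uniq ([:: va i; vb j; va i'; vb j'] ++ [:: va k; vb l; va k'; vb l']).
  by rewrite -(perm_uniq (perm_cat pc pd)).
exists i, i', j, j', k, k', l, l'; split=> //.
  rewrite -(map_inj_uniq va_inj); apply: subseq_uniq U.
  by apply/subseqP; exists [:: true; false; true; false; true; false; true; false].
rewrite -(map_inj_uniq vb_inj); apply: subseq_uniq U.
by apply/subseqP; exists [:: false; true; false; true; false; true; false; true].
Qed.

Section Crossings.
Variable R : realType.

Definition edge_segment (a b : 'I_4) : set 'rV[R]_3 :=
  [set vec3 ((1 - t) * alpha R a) (t * alpha R b) t | t in [set t : R | 0 <= t <= 1]].

Lemma compact_edge_segment a b : compact (edge_segment a b).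
Proof.
pose f (t : R) : 'rV[R]_3 := \sum_(k <- [:: true; false]) (if k then 1 - t else t) *:
  (if k then vec3 (alpha R a) 0 0 else vec3 0 (alpha R b) 1).
have fE t : f t = vec3 ((1 - t) * alpha R a) (t * alpha R b) t.
  rewrite /f 2!big_cons big_nil addr0; apply: vector3P; rewrite !coordE;
  by rewrite !(mulr0, addr0, add0r, mulr1).
have -> : edge_segment a b = f @` `[0, 1].
  by apply/seteqP; split=> _ [t t01 <-]; exists t; rewrite ?fE //; move: t01; rewrite /= in_itv.
apply: continuous_compact; last exact: segment_compact.
apply: continuous_subspaceT; apply: continuous_combination => -[] t.
  by apply: cvgB; [exact: cvg_cst | exact: cvg_id].
exact: cvg_id.
Qed.

Lemma picture_quad i i' j j' :
  @picture R @` realization (quad [set i; i'] [set j; j']) =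
  edge_segment i j `|` edge_segment i j' `|` edge_segment i' j `|` edge_segment i' j'.
Proof.
have in_segment w a b : (forall v, 0 <= w v) -> \sum_v w v = 1 ->
    (forall v, v \notin [set va a; vb b]%SET -> w v = 0) -> edge_segment a b (picture w).
  move=> w0 w1 wN; have [t t01 ->] := edge_pointP (va_neq_vb a b) w0 w1 wN.
  by rewrite pictureE //; exists t.
have of_segment a b p : [set va a; vb b]%SET \in quad [set i; i'] [set j; j'] ->
    edge_segment a b p -> (@picture R @` realization (quad [set i; i'] [set j; j'])) p.
  move=> abQ [t t01 <-]; exists (edge_point (va a) (vb b) t); last by rewrite pictureE.
  exact: edge_point_realization.
rewrite quadE in of_segment *.
apply/seteqP; split=> [_ [w [w0 w1 [s sQ wN]] <-]|p].
  move: sQ wN; rewrite !inE => /or4P[] /eqP-> /(in_segment w _ _ w0 w1) H.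
  - by left; left; left.
  - by left; left; right.
  - by left; right.
  - by right.
by case=> [[[]|]|]; apply: of_segment; rewrite !inE eqxx ?orbT.
Qed.

(** Compares positions in alpha: the indices 0 and 1 are on one side of the
    origin, and 1 and 2 are close to it. *)
Definition nearer (i k : nat) : bool :=
  [&& (i < 2)%N == (k < 2)%N, i \in [:: 1; 2]%N & k \in [:: 0; 3]%N].

(** When the edges (i, j) and (k, l) cross in the view from above, the one
    with the nearer vertex on the lower line has gone only a third of the way
    up, and the other one two thirds. *)
Definition passes_under (i j k l : nat) : bool := nearer i k && nearer l j.

Lemma alpha_proportion (i k : 'I_4) (u v : R) : 0 <= u -> 0 <= v -> i != k ->
  u * alpha R i = v * alpha R k ->
  [\/ u = 0 /\ v = 0, u = 2 * v /\ nearer i k | 2 * u = v /\ nearer k i].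
Proof.
move=> u0 v0 ik E; move: ik E.
case: i => [[|[|[|[|//]]]] ?]; case: k => [[|[|[|[|//]]]] ?] //= _;
rewrite /alpha /nearer /= => E.
all: by [apply: Or31; split; lra | apply: Or32; split=> //; lra | apply: Or33; split=> //; lra].
Qed.

Lemma crossing_height (i j k l : 'I_4) (t u : R) : 0 <= t <= 1 -> 0 <= u <= 1 ->
  i != k -> j != l -> (1 - t) * alpha R i = (1 - u) * alpha R k ->
  t * alpha R j = u * alpha R l -> ~~ passes_under i j k l -> u < t.
Proof.
move=> /andP[t0 t1] /andP[u0 u1] ik jl Ea Eb; rewrite /passes_under.
have := alpha_proportion t0 u0 jl Eb.
have /alpha_proportion : 0 <= 1 - t by rewrite subr_ge0.
move=> /(_ _ _ _ _ ik Ea); rewrite subr_ge0 => /(_ u1).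
case=> [[? ?]|[? ->]|[? _]] [[? ?]|[? _]|[? ->]] // _; lra.
Qed.

Definition lies_above (i i' j j' k k' l l' : nat) : bool :=
  ~~ has (fun p => has (fun q => has (fun r => has (fun s => passes_under p r q s)
    [:: l; l']) [:: j; j']) [:: k; k']) [:: i; i'].

Lemma picture_split (i i' j j' k k' l l' : 'I_4) :
  uniq [:: i; i'; k; k'] -> uniq [:: j; j'; l; l'] ->
  lies_above i i' j j' k k' l l' ->
  split_link (@picture R @` realization (quad [set i; i'] [set j; j']))
             (@picture R @` realization (quad [set k; k'] [set l; l'])).
Proof.
move=> Ua Ub ab; rewrite !picture_quad.
have C4 a a' b b' : compact (edge_segment a b `|` edge_segment a b' `|`
    edge_segment a' b `|` edge_segment a' b').
  by do 3?apply: compactU; apply: compact_edge_segment.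
have N4 a a' b b' : (edge_segment a b `|` edge_segment a b' `|`
    edge_segment a' b `|` edge_segment a' b') !=set0.
  eexists; do 3!left; exists 0; last reflexivity.
  by rewrite /= lexx ler01.
have in4 a a' b b' p : (edge_segment a b `|` edge_segment a b' `|`
    edge_segment a' b `|` edge_segment a' b') p ->
    exists q r, [/\ q \in [:: a; a'], r \in [:: b; b'] & edge_segment q r p].
  by case=> [[[]|]|] H; [exists a, b | exists a, b' | exists a', b | exists a', b'];
    split; rewrite // !inE eqxx ?orbT.
apply: above_split => // _ _ /in4[p [r [pi rj [t t01 <-]]]] /in4[q [s [qk sl [u u01 <-]]]].
move/eqP; rewrite shadowP !vec3E => /andP[/eqP Ex /eqP Ey].
have pq : p != q.
  apply: contraTneq Ua => pq; rewrite -[[:: i; i'; k; k']]/([:: i; i'] ++ [:: k; k']).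
  rewrite cat_uniq; apply/negP => /and3P[_ /hasP[]]; exists q => //.
  by rewrite /= -pq.
have rs : r != s.
  apply: contraTneq Ub => rs; rewrite -[[:: j; j'; l; l']]/([:: j; j'] ++ [:: l; l']).
  rewrite cat_uniq; apply/negP => /and3P[_ /hasP[]]; exists s => //.
  by rewrite /= -rs.
apply: (crossing_height t01 u01 pq rs Ex Ey).
apply: contra ab => under; apply/hasP; exists (val p).
  by rewrite -[[:: _; _]]/(map val [:: i; i']) map_f.
apply/hasP; exists (val q); first by rewrite -[[:: _; _]]/(map val [:: k; k']) map_f.
apply/hasP; exists (val r); first by rewrite -[[:: _; _]]/(map val [:: j; j']) map_f.
by apply/hasP; exists (val s); first by rewrite -[[:: _; _]]/(map val [:: l; l']) map_f.
Qed.

End Crossings.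

Definition linked_pair (i i' : nat) : bool :=
  (i, i') \in [:: (0, 2); (2, 0); (1, 3); (3, 1)]%N.

(** Both cycles pass under each other only if each of them takes, on both
    lines, one near and one far vertex on different sides. *)
Lemma only_two_entangled (i i' j j' k k' l l' : nat) :
  all (fun n => n < 4)%N [:: i; i'; j; j'; k; k'; l; l'] ->
  uniq [:: i; i'; k; k'] -> uniq [:: j; j'; l; l'] ->
  [|| lies_above i i' j j' k k' l l', lies_above k k' l l' i i' j j' |
      linked_pair i i' && linked_pair j j'].
Proof.
pose quads := [seq q <- [seq (pq, rs) | pq <- [seq (p, q) | p <- iota 0 4, q <- iota 0 4],
   rs <- [seq (p, q) | p <- iota 0 4, q <- iota 0 4]] |
   uniq [:: q.1.1; q.1.2; q.2.1; q.2.2]].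
have check : all (fun a => all (fun b =>
    [|| lies_above a.1.1 a.1.2 b.1.1 b.1.2 a.2.1 a.2.2 b.2.1 b.2.2,
        lies_above a.2.1 a.2.2 b.2.1 b.2.2 a.1.1 a.1.2 b.1.1 b.1.2 |
        linked_pair a.1.1 a.1.2 && linked_pair b.1.1 b.1.2]) quads) quads.
  by vm_compute.
have inQ p q r s : (p < 4)%N -> (q < 4)%N -> (r < 4)%N -> (s < 4)%N ->
    uniq [:: p; q; r; s] -> ((p, q), (r, s)) \in quads.
  move=> p4 q4 r4 s4 U; rewrite mem_filter; apply/andP; split=> //.
  by apply: allpairs_f; apply: allpairs_f; rewrite mem_iota.
move=> /= /and5P[i4 i'4 j4 j'4 /and5P[k4 k'4 l4 l'4 _]] Ua Ub.
exact: (allP (allP check _ (inQ _ _ _ _ i4 i'4 k4 k'4 Ua)) _ (inQ _ _ _ _ j4 j'4 l4 l'4 Ub)).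
Qed.

(** * The number of links *)

Lemma nlinks_ge2 (R : realType) (f : bary R K44 -> 'rV[R]_3) :
  embedding f -> (2 <= nlinks f)%N.
Proof.
case=> f_cont _.
have [L [j [isL jL _]]] := link_avoiding_edge va_inj vb_inj va_vb_adj f_cont.
(* Renumbering the blue vertices turns the edge (0, j) of the link L into (0, 0). *)
pose b (i : 'I_4) := vb (tperm ord0 j i).
have b_inj : injective b by move=> i i' /vb_inj /perm_inj.
have [L' [j' [isL' _ N]]] := link_avoiding_edge va_inj b_inj (fun i i' => isT) f_cont.
rewrite /b tpermL in N.
have LL' : L != L' by apply: contraNneq N => <-.
have card2 : #|[set L; L']%SET| = 2%N by rewrite cards2 LL'.
rewrite -[leqLHS]card2.
apply: subset_leq_card; apply/fintype.subsetP => M; rewrite !inE.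
by case/orP=> /eqP->.
Qed.

Lemma split_link_sym (R : realType) (A B : set 'rV[R]_3) :
  split_link A B -> split_link B A.
Proof. by case=> h hh [[? ?]|[? ?]]; exists h => //; [right|left]. Qed.

Lemma linked_pair_set (i i' k k' : 'I_4) : uniq [:: i; i'; k; k'] ->
  linked_pair i i' -> exists b : bool,
  [set i; i']%SET = [set x : 'I_4 | odd x == b]%SET /\
  [set k; k']%SET = [set x : 'I_4 | odd x == ~~ b]%SET.
Proof.
move=> U L; exists (odd i); move: L U.
case: i => [[|[|[|[|//]]]] ?]; case: i' => [[|[|[|[|//]]]] ?] //= _;
case: k => [[|[|[|[|//]]]] ?]; case: k' => [[|[|[|[|//]]]] ?] //= _.
all: by split; apply/setP => -[[|[|[|[|//]]]] ?]; rewrite !inE.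
Qed.

(** On each line the indices of the two cycles alternate; b tells which of the
    two alternating choices on the second line goes with the odd indices of
    the first one. *)
Definition interlaced (b : bool) : {set {set {set K44}}} :=
  [set quad [set x : 'I_4 | odd x == true] [set x : 'I_4 | odd x == b];
       quad [set x : 'I_4 | odd x == false] [set x : 'I_4 | odd x == ~~ b]]%SET.

Lemma nlinks_picture (R : realType) : (nlinks (@picture R) <= 2)%N.
Proof.
rewrite /nlinks; apply: leq_trans (_ : #|[set interlaced true; interlaced false]%SET| <= 2)%N;
  last by rewrite cards2; case: (_ == _).
apply: subset_leq_card; apply/fintype.subsetP => L; rewrite !inE => -[C [D [-> cC cD dis nsplit]]].
have [i [i' [j [j' [k [k' [l [l' [Ua Ub EC ED]]]]]]]]] := disjoint_cycles_K44 cC cD dis.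
move: nsplit; rewrite EC ED => nsplit.
have : all (fun n => n < 4)%N [:: val i; val i'; val j; val j'; val k; val k'; val l; val l'].
  by rewrite /= !ltn_ord.
have vU (p q r s : 'I_4) : uniq [:: p; q; r; s] = uniq [:: val p; val q; val r; val s].
  by rewrite -[RHS](map_inj_uniq val_inj [:: p; q; r; s]).
move/only_two_entangled; rewrite -!vU => /(_ Ua Ub) /or3P[ab|ab|/andP[La Lb]].
- by case: nsplit; apply: picture_split.
- case: nsplit; apply: split_link_sym; apply: picture_split => //.
    by rewrite -(rot_uniq 2).
  by rewrite -(rot_uniq 2).
have [a [-> ->]] := linked_pair_set Ua La; have [b [-> ->]] := linked_pair_set Ub Lb.
rewrite /interlaced; apply/orP; case: a; case: b; [left|right|right|left] => //=;
  by rewrite finset.setUC.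
Qed.

Local Close Scope ring_scope.
Local Close Scope classical_set_scope.

Theorem proposition9 (R : realType) :
  mnl R (complete_multipartite [:: 4; 4]) = 2.
Proof.
have P2 : link_numbers R K44 2.
  exists (@picture R); split; [exact: picture_embedding | exact: straight_tame |].
  by apply/eqP; rewrite eqn_leq nlinks_picture nlinks_ge2 //; apply: picture_embedding.
have le2 m : link_numbers R K44 m -> (2 <= m)%N.
  by case=> f [ef _ <-]; apply: nlinks_ge2.
rewrite /mnl; apply: xget_unique => [|m [Pm m_min]]; first by split.
by apply/eqP; rewrite eqn_leq le2 // m_min.
Qed.
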